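(* Fix $x_0>0$ and let $\gamma^{\rho,x_0}$ be the chordal $\mathrm{SLE}_0(\rho)$ in $\mathbb H$ from $0$, with reference point $\infty$ and force point $x_0$. Then: (i) If $\rho\in(-\infty,-4]$, then $\gamma^{\rho,x_0}(\tau)=x_0$ and the (outer) hitting angle is $\alpha\pi=\pi\frac{4+\rho}{2+\rho}$. Moreover the hitting time is $\tau=-\frac{x_0^2}{2(2+\rho)}$. (ii) If $\rho\in(-4,-2)$, then $\gamma^{\rho,x_0}(\tau)=-\frac{2}{\rho+2}x_0>x_0$ and the (outer) hitting angle is $\alpha\pi=\pi\frac{4+\rho}{2}$. Moreover the hitting time is $\tau=-\frac{x_0^2}{2(2+\rho)}$. (iii) If $\rho=-2$, then $\gamma^{\rho,x_0}$ approaches $\infty$ asymptotic to $\{x+i\pi x_0:x\in\mathbb R^+\}$. (iv) If $\rho\in(-2,\infty)$, then $\gamma^{\rho,x_0}$ approaches $\infty$ at an angle $\alpha\pi=\pi\frac{2+\rho}{4+\rho}$.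
   Context: $\mathbb H$ is the upper half-plane. The chordal $\mathrm{SLE}_0(\rho)$ from $0$ with reference point $\infty$ and force point $x_0$ is the curve whose (half-plane capacity) driving function solves $\dot W_t=\frac{\rho}{W_t-x_t}$, $W_0=0$, with $x_t=g_t(x_0)$, $\partial_tg_t(z)=\frac2{g_t(z)-W_t}$, $g_0(z)=z$, and $\gamma(t)=\lim_{y\to0+}g_t^{-1}(W_t+iy)$, run up to $\tau_{0+}=\lim_{\varepsilon\to0+}\inf\{t:|W_t-x_t|=\varepsilon\}$. In (i) and (ii), $\tau=\tau_{0+}$ is the time at which the curve terminates on the real line, and $\gamma(\tau)$ is the limit of $\gamma(t)$ as $t\to\tau-$. The outer hitting angle is the angle at $\gamma(\tau)$ between the curve and the half-line $[\gamma(\tau),\infty)$, measured in the unbounded component of $\mathbb H\setminus\gamma$. In (iv), approaching $\infty$ at an angle $\alpha\pi$ means $\gamma(t)\to\infty$ with $\arg\gamma(t)\to\alpha\pi$. *)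

(* Defs.v *)
(* Stdlib reals with Coquelicot; the complex numbers are Coquelicot's C. *)
From Stdlib Require Import Reals.
From Coquelicot Require Import Coquelicot.

Open Scope R_scope.

Definition halfplane (z : C) : Prop := 0 < Im z.

(* Principal argument, in (-PI, PI]; the value at 0 is junk. *)
Definition Carg (z : C) : R :=
  if Rle_dec 0 (Im z) then acos (Re z / Cmod z) else - acos (Re z / Cmod z).

Definition upto (T : Rbar) (t : R) : Prop := 0 <= t /\ Rbar_lt t T.

(* The filter t -> T-; this is t -> +oo when T = p_infty. *)
Definition before (T : Rbar) : (R -> Prop) -> Prop :=
  within (fun t => Rbar_lt t T) (Rbar_locally T).

(* u is a solution on [0,T) of u' = 2 / (u - W), u(0) = z. The derivative is
   only asked for in the open interval because is_derive is two-sided and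
   functions of time are meaningless outside [0,T). *)
Definition loewner_trajectory (W : R -> R) (T : Rbar) (z : C) (u : R -> C)
    : Prop :=
  u 0 = z /\
  continuous_on (upto T) u /\
  (forall t, upto T t -> u t <> RtoC (W t)) /\
  (forall t, upto T t -> 0 < t ->
     is_derive (K := R_AbsRing) (V := C_R_NormedModule) u t
       (2 / (u t - W t))%C).

(* g_t(z) = w, for a driving function W given on [0,T). That S is strictly
   larger than t says that z is not swallowed by time t. *)
Definition loewner_map (W : R -> R) (T : Rbar) (t : R) (z w : C) : Prop :=
  exists (S : Rbar) (u : R -> C),
    Rbar_lt t S /\ Rbar_le S T /\ loewner_trajectory W S z u /\ u t = w.

(* h restricts to the inverse g_t^{-1} : H -> H \ K_t. *)
Definition loewner_inverse (W : R -> R) (T : Rbar) (t : R) (h : C -> C)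
    : Prop :=
  forall w, halfplane w -> halfplane (h w) /\ loewner_map W T t (h w) w.

(* inf {t : |W_t - x_t| = eps}, which is p_infty if there is no such t. *)
Definition gap_time (W x : R -> R) (T : Rbar) (eps : R) : Rbar :=
  Glb_Rbar (fun t => upto T t /\ Rabs (W t - x t) = eps).

(* f(eps) -> l as eps -> 0+, for the order topology of the extended reals. *)
Definition is_lim_right0 (f : R -> Rbar) (l : Rbar) : Prop :=
  (forall a : Rbar, Rbar_lt a l -> at_right 0 (fun eps => Rbar_lt a (f eps))) /\
  (forall b : Rbar, Rbar_lt l b -> at_right 0 (fun eps => Rbar_lt (f eps) b)).

(* gamma, on [0,tau), is the chordal SLE_0(rho) in the upper half-plane from 0
   to infinity with force point x0. The driving pair lives on [0,tau); the
   last field forces tau to be the full lifetime, since on a shorter interval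
   |W - x| stays away from 0 and gap_time is p_infty for small eps. *)
Record chordal_SLE0 (rho x0 : R) (W x : R -> R) (tau : Rbar) (gamma : R -> C)
    : Prop := {
  sle0_W0 : W 0 = 0;
  sle0_W_cont : continuous_on (upto tau) W;
  sle0_W_ode : forall t, upto tau t -> 0 < t ->
    is_derive W t (rho / (W t - x t));
  sle0_x : loewner_trajectory W tau x0 (fun t => RtoC (x t));
  sle0_gamma : forall t, upto tau t ->
    exists h : C -> C, loewner_inverse W tau t h /\
      filterlim (fun y : R => h (W t + Ci * y)%C) (at_right 0)
        (locally (gamma t));
  sle0_tau : is_lim_right0 (gap_time W x tau) tau
}.

Definition connected_set (S : C -> Prop) : Prop :=
  forall A B : C -> Prop, open A -> open B ->
    (forall z, S z -> A z \/ B z) ->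
    (exists z, S z /\ A z) -> (exists z, S z /\ B z) ->
    exists z, S z /\ A z /\ B z.

Definition component (E : C -> Prop) (z w : C) : Prop :=
  exists S : C -> Prop, connected_set S /\ (forall v, S v -> E v) /\ S z /\ S w.

Definition in_unbounded_component (E : C -> Prop) (z : C) : Prop :=
  forall M : R, exists w, component E z w /\ M < Cmod w.

Definition curve_complement (gamma : R -> C) (tau : Rbar) (z : C) : Prop :=
  halfplane z /\ forall t, upto tau t -> z <> gamma t.

(* The curve ends at the real point p in the direction exp(i theta). The last
   two clauses say that the angle is measured in the unbounded component of
   the complement of the curve: that component contains, near p, the sector
   between the half-line [p,oo) and the curve, and it lies along the half-line
   (this is what remains when theta = 0 and the sector is empty). *)
Definition outer_hitting_angle (gamma : R -> C) (tau : Rbar) (p theta : R)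
    : Prop :=
  0 <= theta <= PI /\
  filterlim gamma (before tau) (locally (RtoC p)) /\
  filterlim (fun t => Carg (gamma t - p)%C) (before tau) (locally theta) /\
  (forall phi, 0 < phi < theta ->
     at_right 0 (fun r => in_unbounded_component (curve_complement gamma tau)
                            (p + r * (cos phi, sin phi))%C)) /\
  (forall q, p < q ->
     at_right 0 (fun y => in_unbounded_component (curve_complement gamma tau)
                            (q + Ci * y)%C)).

Definition tends_to_infinity (gamma : R -> C) (tau : Rbar) : Prop :=
  filterlim (fun t => Cmod (gamma t)) (before tau) (Rbar_locally p_infty).

Definition asymptotic_to (gamma : R -> C) (tau : Rbar) (L : C -> Prop) : Prop :=
  forall eps, 0 < eps ->
    before tau (fun t => exists z, L z /\ Cmod (gamma t - z)%C < eps).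

(* Main.v *)
(* Put D = x - W and k = 2 + rho. Then D^2 = x0^2 + 2 k t, which gives the
   lifetime. If c is real and c' = 2 / (c - W), every solution u of the Loewner
   equation satisfies (log (u - c))' = - 2 / ((c - W) (u - W)). For k <> 0 this
   applies to c = x and to c = W - 2 D / k, and shows that
     k log (u - x) + 2 log (u - W + 2 D / k)
   is conserved. For k = 0 the conserved quantity is u + x0 log (u - x), and for
   k = -2, when the two logarithmic singularities merge, it is
   log (u - x) - D / (u - x). Evaluating at the tip u = W shows that the curve
   lies on an explicit level line of an imaginary part, along which the real
   part is a function of D, or of W when k = 0: the real part locates the end
   of the curve and the imaginary part gives its direction. Solutions that end
   at W_t + i y are provided by the definition of the curve, so no existence
   theorem is needed. The angle is measured on the outer side because the level
   line does not meet the sector between its end direction and the half-line,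
   and that sector is a union of rays. *)

Require Import Defs.
From Stdlib Require Import Reals Lra Psatz ClassicalEpsilon.
From Coquelicot Require Import Coquelicot.

Open Scope R_scope.

(** * Arguments and logarithms in the upper half-plane *)

(** Derivatives are given only for t > 0, and [gamma t] only as a limit of points [h y] that the
    flow sends to W_t + i y. Each identity therefore needs two passages to the limit: s -> 0+ along
    a trajectory, to reach its starting point, and then y -> 0+ at the tip. The complex logarithm is
    carried as the pair [ln (Cmod _)], [Carg _]; for real c the point u - c stays in the open upper
    half-plane, so no branch ever changes. The second limit is the delicate one. The logarithms are
    continuous at [gamma t] only if this point avoids their singularities, which the definition of
    the curve does not say. It holds because the conserved quantity has a finite limit, while it is
    unbounded near each singularity. For rho < -4 and for -4 < rho < -2 the curve ends at the
    singularity whose weight is larger in absolute value. The two points exchange their roles at rho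
    = -4, so one lemma about an abstract level line covers both ranges. *)

(** The derivative of acos blows up at -1 and 1, that is, on the real axis, where the limits are
    taken; so a uniform modulus is made explicit. Write a = acos u, b = acos v and cos a - cos b =
    -2 sin((a-b)/2) sin((a+b)/2). If |a-b| >= m then, as a and b lie in [0, PI], both sines are at
    least sin(m/2) in absolute value. *)
Lemma acos_modulus (eps u v : R) :
  0 < eps -> -1 <= u <= 1 -> -1 <= v <= 1 ->
  Rabs (u - v) < 2 * sin (Rmin eps PI / 2) ^ 2 ->
  Rabs (acos u - acos v) < eps.
Proof.
intros He Hu Hv Huv.
apply Rlt_le_trans with (Rmin eps PI); [|apply Rmin_l].
assert (HP := PI_RGT_0).
assert (Hm0 : 0 < Rmin eps PI) by (apply Rmin_pos; assumption).
assert (Hm1 := Rmin_r eps PI).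
set (m := Rmin eps PI) in *; clearbody m; clear eps He.
destruct (Rlt_le_dec (Rabs (acos u - acos v)) m) as [H|H]; [exact H|exfalso].
apply (Rlt_irrefl (2 * sin (m / 2) ^ 2)).
apply Rle_lt_trans with (2 := Huv).
rewrite <- (cos_acos u Hu), <- (cos_acos v Hv) at 1.
assert (Ba := acos_bound u); assert (Bb := acos_bound v).
set (a := acos u) in *; set (b := acos v) in *; clearbody a b; clear u v Hu Hv Huv.
rewrite form2, !Rabs_mult, (Rabs_left (-2)) by lra.
assert (Hs : forall d s, m <= d <= PI -> d / 2 <= s <= PI - d / 2 ->
   sin (m / 2) <= Rabs (sin (d / 2)) /\ sin (m / 2) <= Rabs (sin s)).
{ intros d s Hd Hs.
  assert (H1 : sin (m / 2) <= sin (d / 2)) by (apply sin_incr_1; lra).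
  assert (H2 : 0 <= sin (m / 2)) by (apply sin_ge_0; lra).
  assert (H3 : sin (d / 2) <= sin s).
  { destruct (Rle_dec s (PI / 2)).
    - apply sin_incr_1; lra.
    - rewrite <- (sin_PI_x s). apply sin_incr_1; lra. }
  rewrite !Rabs_pos_eq by lra; lra. }
assert (H0 : 0 <= sin (m / 2)) by (apply sin_ge_0; lra).
unfold Rabs in H at 1; destruct (Rcase_abs (a - b)).
- destruct (Hs (b - a) ((a + b) / 2)) as [H1 H2]; try lra.
  replace ((a - b) / 2) with (- ((b - a) / 2)) by lra.
  rewrite sin_neg, Rabs_Ropp.
  assert (sin (m/2) * sin (m/2) <= Rabs (sin ((b - a) / 2)) * Rabs (sin ((a + b) / 2)))
    by (apply Rmult_le_compat; assumption).
  lra.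
- destruct (Hs (a - b) ((a + b) / 2)) as [H1 H2]; try lra.
  assert (sin (m/2) * sin (m/2) <= Rabs (sin ((a - b) / 2)) * Rabs (sin ((a + b) / 2)))
    by (apply Rmult_le_compat; assumption).
  lra.
Qed.

Lemma acos_modulus_pos (eps : R) :
  0 < eps -> 0 < 2 * sin (Rmin eps PI / 2) ^ 2.
Proof.
intros He. assert (HP := PI_RGT_0).
assert (Hm0 : 0 < Rmin eps PI) by (apply Rmin_pos; assumption).
assert (Hm1 := Rmin_r eps PI).
assert (0 < sin (Rmin eps PI / 2)) by (apply sin_gt_0; lra).
nra.
Qed.

Lemma Carg_upper (z : C) : 0 <= Im z -> Carg z = acos (Re z / Cmod z).
Proof.
intros Hz; unfold Carg; destruct (Rle_dec 0 (Im z)); [reflexivity|contradiction].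
Qed.

Lemma Re_div_Cmod_bound (z : C) : -1 <= Re z / Cmod z <= 1.
Proof.
destruct (Req_dec (Cmod z) 0) as [H|H].
- rewrite H; unfold Rdiv; rewrite Rinv_0; lra.
- assert (H0 := Cmod_ge_0 z); assert (H1 := re_le_Cmod z).
  apply Rabs_le_between.
  rewrite Rabs_div, (Rabs_pos_eq (Cmod z)) by assumption.
  apply Rle_div_l; lra.
Qed.

Lemma Cmod_pair_sqr (a b : R) : Cmod (a, b) ^ 2 = a ^ 2 + b ^ 2.
Proof. apply Cmod2_alt. Qed.

Lemma filterlim_C_iff {T : Type} (F : (T -> Prop) -> Prop) {FF : Filter F}
    (f : T -> C) (z : C) :
  filterlim f F (locally z) <->
  forall eps, 0 < eps -> F (fun t => Cmod (f t - z)%C < eps).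
Proof.
split.
- intros H eps He.
  (* A [ball] of C bounds the two coordinates separately; comparison with [Cmod] costs a factor sqrt
     2. *)
  assert (H2 : 0 < sqrt 2) by (apply sqrt_lt_R0; lra).
  assert (He' : 0 < eps / sqrt 2) by (apply Rdiv_lt_0_compat; assumption).
  specialize (H (ball z (mkposreal _ He')) (locally_ball z (mkposreal _ He'))).
  unfold filtermap in H. revert H; apply filter_imp; intros t Ht.
  assert (H3 := C_NormedModule_mixin_compat2 z (f t) (mkposreal _ He') Ht).
  simpl in H3. change (Cmod (f t - z)%C < sqrt 2 * (eps / sqrt 2)) in H3.
  replace (sqrt 2 * (eps / sqrt 2)) with eps in H3 by (field; lra).
  exact H3.
- intros H P [d Hd]. generalize (H d (cond_pos d)).
  unfold filtermap; apply filter_imp; intros t Ht.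
  apply Hd. apply C_NormedModule_mixin_compat1. exact Ht.
Qed.

Lemma filterlim_R_iff {T : Type} (F : (T -> Prop) -> Prop) {FF : Filter F}
    (f : T -> R) (l : R) :
  filterlim f F (locally l) <->
  forall eps, 0 < eps -> F (fun t => Rabs (f t - l) < eps).
Proof.
split.
- intros H eps He. apply (H _ (locally_ball l (mkposreal _ He))).
- intros H P [d Hd]. generalize (H d (cond_pos d)).
  unfold filtermap; apply filter_imp; intros t Ht. apply Hd, Ht.
Qed.

Lemma Cmod_close (z w : C) : Rabs (Cmod z - Cmod w) <= Cmod (z - w)%C.
Proof.
apply Rabs_le_between; split.
- assert (H := Cmod_triangle z (w - z)%C).
  replace (z + (w - z))%C with w in H by ring.
  replace (w - z)%C with (- (z - w))%C in H by ring.
  rewrite Cmod_opp in H. lra.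
- assert (H := Cmod_triangle w (z - w)%C).
  replace (w + (z - w))%C with z in H by ring. lra.
Qed.

Lemma filterlim_Cmod {T : Type} (F : (T -> Prop) -> Prop) {FF : Filter F}
    (f : T -> C) (z : C) :
  filterlim f F (locally z) ->
  filterlim (fun t => Cmod (f t)) F (locally (Cmod z)).
Proof.
intros H. apply filterlim_R_iff; [exact FF|]; intros eps He.
generalize (proj1 (filterlim_C_iff F f z) H eps He).
apply filter_imp; intros t Ht.
apply Rle_lt_trans with (2 := Ht), Cmod_close.
Qed.

Lemma filterlim_Re {T : Type} (F : (T -> Prop) -> Prop) {FF : Filter F}
    (f : T -> C) (z : C) :
  filterlim f F (locally z) ->
  filterlim (fun t => Re (f t)) F (locally (Re z)).
Proof.
intros H. apply filterlim_R_iff; [exact FF|]; intros eps He.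
generalize (proj1 (filterlim_C_iff F f z) H eps He).
apply filter_imp; intros t Ht.
apply Rle_lt_trans with (2 := Ht).
apply (re_le_Cmod (f t - z)%C).
Qed.

Lemma im_le_Cmod (z : C) : Rabs (Im z) <= Cmod z.
Proof. apply Rle_trans with (2 := Rmax_Cmod z), Rmax_r. Qed.

Lemma filterlim_Im {T : Type} (F : (T -> Prop) -> Prop) {FF : Filter F}
    (f : T -> C) (z : C) :
  filterlim f F (locally z) ->
  filterlim (fun t => Im (f t)) F (locally (Im z)).
Proof.
intros H. apply filterlim_R_iff; [exact FF|]; intros eps He.
generalize (proj1 (filterlim_C_iff F f z) H eps He).
apply filter_imp; intros t Ht.
apply Rle_lt_trans with (2 := Ht).
apply (im_le_Cmod (f t - z)%C).
Qed.

Lemma filterlim_Cminus_const {T : Type} (F : (T -> Prop) -> Prop) {FF : Filter F}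
    (f : T -> C) (z c : C) :
  filterlim f F (locally z) ->
  filterlim (fun t => f t - c)%C F (locally (z - c)%C).
Proof.
intros H. apply filterlim_C_iff; [exact FF|]; intros eps He.
generalize (proj1 (filterlim_C_iff F f z) H eps He).
apply filter_imp; intros t Ht.
replace (f t - c - (z - c))%C with (f t - z)%C by ring. exact Ht.
Qed.

Lemma filterlim_lin2 {T : Type} (F : (T -> Prop) -> Prop) {FF : Filter F}
    (f g : T -> R) (a b l m : R) :
  filterlim f F (locally l) -> filterlim g F (locally m) ->
  filterlim (fun t => a * f t + b * g t) F (locally (a * l + b * m)).
Proof.
intros Hf Hg.
apply (filterlim_comp_2 (G := locally (a * l)) (H := locally (b * m))
  (fun t => a * f t) (fun t => b * g t) Rplus).
- apply (filterlim_comp _ _ _ f (fun r => a * r) F (locally l) _ Hf).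
  apply (filterlim_scal_r a l).
- apply (filterlim_comp _ _ _ g (fun r => b * r) F (locally m) _ Hg).
  apply (filterlim_scal_r b m).
- apply (filterlim_plus (a * l) (b * m)).
Qed.

Lemma filterlim_ln {T : Type} (F : (T -> Prop) -> Prop) {FF : Filter F}
    (f : T -> R) (l : R) :
  0 < l -> filterlim f F (locally l) ->
  filterlim (fun t => ln (f t)) F (locally (ln l)).
Proof.
intros Hl Hf. apply (filterlim_comp _ _ _ f ln F (locally l) _ Hf).
apply (continuous_ln l Hl).
Qed.

Lemma filterlim_ln_Cmod {T : Type} (F : (T -> Prop) -> Prop) {FF : Filter F}
    (f : T -> C) (z : C) :
  z <> 0%C -> filterlim f F (locally z) ->
  filterlim (fun t => ln (Cmod (f t))) F (locally (ln (Cmod z))).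
Proof.
intros Hz Hf. apply filterlim_ln; [exact FF| |].
- apply Cmod_gt_0, Hz.
- apply filterlim_Cmod; assumption.
Qed.

(** The limit z may be real, and [Carg] jumps across the negative axis; this is why f is kept in the
    closed upper half-plane, where [Carg] is acos of a continuous quotient. *)
Lemma filterlim_Carg {T : Type} (F : (T -> Prop) -> Prop) {FF : Filter F}
    (f : T -> C) (z : C) :
  z <> 0%C -> 0 <= Im z -> F (fun t => 0 <= Im (f t)) ->
  filterlim f F (locally z) ->
  filterlim (fun t => Carg (f t)) F (locally (Carg z)).
Proof.
intros Hz Iz If Hf.
apply filterlim_R_iff; [exact FF|]; intros eps He.
assert (H : filterlim (fun t => Re (f t) / Cmod (f t)) F
              (locally (Re z / Cmod z))).
{ apply (filterlim_comp_2 (G := locally (Re z)) (H := locally (/ Cmod z))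
    (fun t => Re (f t)) (fun t => / Cmod (f t)) Rmult).
  - apply filterlim_Re; assumption.
  - apply (filterlim_comp _ _ _ (fun t => Cmod (f t)) Rinv F (locally (Cmod z)) _
      (filterlim_Cmod F f z Hf)).
    apply (continuous_Rinv (Cmod z)).
    apply Rgt_not_eq, Cmod_gt_0, Hz.
  - apply (filterlim_mult (Re z) (/ Cmod z)). }
generalize (proj1 (filterlim_R_iff F _ _) H _ (acos_modulus_pos eps He)).
intros H'. generalize (filter_and _ _ If H'). apply filter_imp.
intros t [Ht1 Ht2]. rewrite !Carg_upper by assumption.
apply acos_modulus; try apply Re_div_Cmod_bound; assumption.
Qed.

(** A smooth formula on the whole open half-plane, with no case split at a = 0, from which the
    argument can be differentiated. *)
Lemma Carg_atan (a b : R) : 0 < b -> Carg (a, b) = PI / 2 - atan (a / b).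
Proof.
intros Hb. rewrite Carg_upper by (apply Rlt_le, Hb).
assert (HP := atan_bound (a / b)).
rewrite <- (acos_cos (PI / 2 - atan (a / b))) by lra.
f_equal. rewrite cos_shift, sin_atan. unfold Cmod; simpl fst; simpl snd; simpl Re.
assert (H : 0 < sqrt (a ^ 2 + b ^ 2)) by (apply sqrt_lt_R0; nra).
replace (1 + (a / b)²) with ((a ^ 2 + b ^ 2) / b ^ 2)
  by (unfold Rsqr; field; lra).
rewrite sqrt_div_alt by nra. rewrite sqrt_pow2 by lra. field; lra.
Qed.

(* The hypotheses say that (a + i b)' = (a + i b) (l + i m). *)
Lemma log_derivative (a b : R -> R) (s l m : R) :
  0 < b s ->
  is_derive a s (a s * l - b s * m) ->
  is_derive b s (a s * m + b s * l) ->
  is_derive (fun r => ln (Cmod (a r, b r))) s l /\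
  is_derive (fun r => Carg (a r, b r)) s m.
Proof.
intros Hb Da Db.
assert (Ea : Derive (fun r : R => a r) s = a s * l - b s * m)
  by apply is_derive_unique, Da.
assert (Eb : Derive (fun r : R => b r) s = a s * m + b s * l)
  by apply is_derive_unique, Db.
assert (Hn : 0 < a s ^ 2 + b s ^ 2) by nra.
split.
- apply is_derive_ext with (fun r => ln (sqrt (a r ^ 2 + b r ^ 2))); [reflexivity|].
  assert (Hq : 0 < sqrt (a s ^ 2 + b s ^ 2)) by (apply sqrt_lt_R0, Hn).
  auto_derive.
  + repeat split; try (eexists; eassumption).
    * simpl in Hn; rewrite !Rmult_1_r in *; lra.
    * simpl in Hq; rewrite !Rmult_1_r in *; lra.
      + rewrite Ea, Eb.
    replace (a s * (a s * 1) + b s * (b s * 1)) with (a s ^ 2 + b s ^ 2) by ring.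
    set (q := sqrt (a s ^ 2 + b s ^ 2)) in *.
    assert (Hq2 : q * q = a s ^ 2 + b s ^ 2) by (apply sqrt_sqrt; lra).
    apply Rmult_eq_reg_r with (q * q); [|nra].
    transitivity (l * (a s ^ 2 + b s ^ 2)); [field; lra|rewrite Hq2; ring].
- apply is_derive_ext_loc with (fun r => PI / 2 - atan (a r / b r)).
  + assert (Cb : continuous b s)
      by (apply (ex_derive_continuous b s); eexists; exact Db).
    assert (Pb : locally (b s) (fun r => 0 < r)) by apply (open_gt 0 (b s) Hb).
    generalize (Cb _ Pb). unfold filtermap.
    apply filter_imp; intros r Hr. symmetry; apply Carg_atan, Hr.
  + auto_derive.
    * repeat split; try (eexists; eassumption); lra.
    * rewrite Ea, Eb.
      field; split; [lra|nra].
Qed.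

(** At 0 only a right limit is known. For s in (0, t) the vanishing derivative gives f s = f t, and
    s -> 0+ concludes. *)
Lemma constant_from_right (f : R -> R) (t : R) :
  0 <= t -> (forall s, 0 < s <= t -> is_derive f s 0) ->
  filterlim f (at_right 0) (locally (f 0)) -> f t = f 0.
Proof.
intros Ht Hd Hc. destruct Ht as [Ht|<-]; [|reflexivity].
apply (filterlim_locally_unique (F := at_right 0) f); [|exact Hc].
apply filterlim_ext_loc with (fun _ => f t); [|apply filterlim_const].
exists (mkposreal t Ht). intros s Hs Hs0. symmetry.
assert (Hst : s < t).
{ change (Rabs (s - 0) < t) in Hs. apply Rabs_def2 in Hs; lra. }
apply (eq_is_derive f s t); [|exact Hst].
intros r Hr; apply Hd; lra.
Qed.

Lemma upto_filter (S : Rbar) :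
  upto S 0 -> filterlim (fun r => r) (at_right 0) (within (upto S) (locally 0)).
Proof.
intros [_ HS] P HP. unfold filtermap. unfold within in HP.
assert (HS' : locally 0 (fun r => Rbar_lt r S)) by (apply open_Rbar_lt, HS).
generalize (filter_and _ _ HP HS'). unfold at_right, within.
apply filter_imp; intros r [H1 H2] Hr. apply H1; split; [lra|exact H2].
Qed.

Lemma continuous_on_right0 {U : UniformSpace} (S : Rbar) (f : R -> U) :
  upto S 0 -> continuous_on (upto S) f ->
  filterlim f (at_right 0) (locally (f 0)).
Proof.
intros H0 Hf. apply (filterlim_comp _ _ _ (fun r => r) f) with (1 := upto_filter S H0).
apply Hf, H0.
Qed.

Lemma is_derive_C (u : R -> C) (t : R) (c : C) :
  is_derive (K := R_AbsRing) (V := C_R_NormedModule) u t c ->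
  is_derive (fun s => Re (u s)) t (Re c) /\ is_derive (fun s => Im (u s)) t (Im c).
Proof.
intros H; split.
- apply (filterdiff_comp' u (fun z : C_R_NormedModule => Re z) t
    (fun y => scal y c) (fun z => Re z) H).
  apply filterdiff_linear, (is_linear_fst (U := R_NormedModule) (V := R_NormedModule)).
- apply (filterdiff_comp' u (fun z : C_R_NormedModule => Im z) t
    (fun y => scal y c) (fun z => Im z) H).
  apply filterdiff_linear, (is_linear_snd (U := R_NormedModule) (V := R_NormedModule)).
Qed.

(** * The driving pair and the lifetime *)

Lemma upto_le (T : Rbar) (s t : R) : 0 <= s <= t -> upto T t -> upto T s.
Proof.
intros Hs [_ Ht]; split; [lra|].
apply Rbar_le_lt_trans with t; [apply Hs|exact Ht].
Qed.

Lemma sle0_x_derive (rho x0 : R) (W x : R -> R) (tau : Rbar) (gamma : R -> C) :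
  chordal_SLE0 rho x0 W x tau gamma ->
  forall t, upto tau t -> 0 < t -> is_derive x t (2 / (x t - W t)).
Proof.
intros [_ _ _ [_ [_ [Hn Hd]]] _ _] t Ht Ht0.
destruct (is_derive_C _ _ _ (Hd t Ht Ht0)) as [H _].
assert (x t - W t <> 0).
{ intros E. apply (Hn t Ht). f_equal. lra. }
assert (E : Re (2 / (x t - W t))%C = 2 / (x t - W t)).
{ rewrite <- RtoC_minus, <- RtoC_div by assumption. reflexivity. }
rewrite E in H. exact H.
Qed.

Lemma sle0_gap_neq0 (rho x0 : R) (W x : R -> R) (tau : Rbar) (gamma : R -> C) :
  chordal_SLE0 rho x0 W x tau gamma ->
  forall t, upto tau t -> x t - W t <> 0.
Proof.
intros [_ _ _ [_ [_ [Hn _]]] _ _] t Ht E.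
apply (Hn t Ht). f_equal. lra.
Qed.

Lemma sle0_gap_derive (rho x0 : R) (W x : R -> R) (tau : Rbar) (gamma : R -> C) :
  chordal_SLE0 rho x0 W x tau gamma ->
  forall t, upto tau t -> 0 < t ->
  is_derive (fun s => x s - W s) t ((2 + rho) / (x t - W t)).
Proof.
intros Hs t Ht Ht0.
assert (H := sle0_gap_neq0 _ _ _ _ _ _ Hs t Ht).
replace ((2 + rho) / (x t - W t)) with (2 / (x t - W t) - rho / (W t - x t))
  by (field; lra).
apply (is_derive_minus x W).
- exact (sle0_x_derive _ _ _ _ _ _ Hs t Ht Ht0).
- exact (sle0_W_ode _ _ _ _ _ _ Hs t Ht Ht0).
Qed.

Lemma sle0_x_right0 (rho x0 : R) (W x : R -> R) (tau : Rbar) (gamma : R -> C) :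
  chordal_SLE0 rho x0 W x tau gamma -> upto tau 0 ->
  filterlim x (at_right 0) (locally x0) /\ x 0 = x0.
Proof.
intros [_ _ _ [H0 [Hc _]] _ _] Ht.
assert (E : x 0 = x0) by (injection H0; trivial).
split; [|exact E]. rewrite <- E.
apply (filterlim_Re (at_right 0) (fun t => RtoC (x t)) (RtoC (x 0))).
exact (continuous_on_right0 tau _ Ht Hc).
Qed.

Lemma sle0_W_right0 (rho x0 : R) (W x : R -> R) (tau : Rbar) (gamma : R -> C) :
  chordal_SLE0 rho x0 W x tau gamma -> upto tau 0 ->
  filterlim W (at_right 0) (locally 0).
Proof.
intros Hs Ht.
rewrite <- (sle0_W0 _ _ _ _ _ _ Hs) at 2.
exact (continuous_on_right0 tau _ Ht (sle0_W_cont _ _ _ _ _ _ Hs)).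
Qed.

Lemma sle0_gap_right0 (rho x0 : R) (W x : R -> R) (tau : Rbar) (gamma : R -> C) :
  chordal_SLE0 rho x0 W x tau gamma -> upto tau 0 ->
  filterlim (fun s => x s - W s) (at_right 0) (locally x0).
Proof.
intros Hs Ht.
destruct (sle0_x_right0 _ _ _ _ _ _ Hs Ht) as [Hx _].
assert (HW := sle0_W_right0 _ _ _ _ _ _ Hs Ht).
replace x0 with (1 * x0 + -1 * 0) by ring.
apply filterlim_ext with (fun t => 1 * x t + -1 * W t); [intros; ring|].
apply filterlim_lin2; try assumption. apply at_right_proper_filter.
Qed.

Lemma sle0_gap_sqr (rho x0 : R) (W x : R -> R) (tau : Rbar) (gamma : R -> C) :
  chordal_SLE0 rho x0 W x tau gamma ->
  forall t, upto tau t -> (x t - W t) ^ 2 = x0 ^ 2 + 2 * (2 + rho) * t.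
Proof.
intros Hs t Ht.
assert (H0 : upto tau 0) by (apply upto_le with t; [split; [lra|apply Ht]|exact Ht]).
set (f := fun s => (x s - W s) ^ 2 - 2 * (2 + rho) * s).
assert (Hf0 : f 0 = x0 ^ 2).
{ unfold f. rewrite (proj2 (sle0_x_right0 _ _ _ _ _ _ Hs H0)), (sle0_W0 _ _ _ _ _ _ Hs).
  ring. }
assert (H : f t = f 0).
{ apply constant_from_right.
  - apply Ht.
  - intros s Hst. unfold f.
    assert (Hu : upto tau s) by (apply upto_le with t; [lra|exact Ht]).
    assert (D := sle0_gap_derive _ _ _ _ _ _ Hs s Hu (proj1 Hst)).
    assert (Hn := sle0_gap_neq0 _ _ _ _ _ _ Hs s Hu).
    set (g := fun s => x s - W s) in *. change (x s - W s) with (g s) in *.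
    apply is_derive_ext with (fun r => g r ^ 2 - 2 * (2 + rho) * r); [reflexivity|].
    auto_derive.
    + repeat split; eexists; exact D.
    + assert (E : Derive (fun r : R => g r) s = (2 + rho) / g s)
        by apply is_derive_unique, D.
      rewrite E. field; exact Hn.
  - rewrite Hf0.
    assert (HD := sle0_gap_right0 _ _ _ _ _ _ Hs H0).
    apply filterlim_ext with
      (fun s => 1 * ((x s - W s) * (x s - W s)) + - (2 * (2 + rho)) * s);
      [intros; unfold f; ring|].
    replace (x0 ^ 2) with (1 * (x0 * x0) + - (2 * (2 + rho)) * 0) by ring.
    apply filterlim_lin2; [apply at_right_proper_filter| |].
    + apply (filterlim_comp_2 (G := locally x0) (H := locally x0)
        (fun s => x s - W s) (fun s => x s - W s) Rmult HD HD).
      apply (filterlim_mult x0 x0).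
    + intros P HP. unfold filtermap, at_right, within. revert HP. apply filter_imp; auto. }
unfold f in H at 1. lra.
Qed.

(** The right limit supplies some s in (0, t) with f s > 0; a negative value at t would give a zero
    between s and t. *)
Lemma positive_from_right (f : R -> R) (l t : R) :
  0 < l -> 0 < t -> filterlim f (at_right 0) (locally l) ->
  (forall s, 0 < s <= t -> continuous f s) ->
  (forall s, 0 < s <= t -> f s <> 0) -> 0 < f t.
Proof.
intros Hl Ht Hf Hc Hn.
destruct (Rlt_le_dec 0 (f t)) as [H|[H|H]]; [exact H| |elim (Hn t); lra].
exfalso.
assert (Pl : locally l (fun r => 0 < r)) by apply (open_gt 0 l Hl).
destruct (Hf _ Pl) as [d Hd].
set (s := Rmin (d / 2) (t / 2)).
assert (Hd0 := cond_pos d).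
assert (Hs0 : 0 < s) by (apply Rmin_pos; lra).
assert (Hs1 : s <= d / 2) by apply Rmin_l.
assert (Hs2 : s <= t / 2) by apply Rmin_r.
assert (Hfs : 0 < f s).
{ apply Hd; [|exact Hs0]. change (Rabs (s - 0) < d). rewrite Rabs_pos_eq; lra. }
destruct (Ranalysis5.IVT_interv (fun r => - f r) s t) as [z [Hz1 Hz2]]; try lra.
- intros a Ha. apply continuity_pt_filterlim, (continuous_opp f), Hc; lra.
- apply (Hn z); lra.
Qed.

Lemma sle0_gap_pos (rho x0 : R) (W x : R -> R) (tau : Rbar) (gamma : R -> C) :
  0 < x0 -> chordal_SLE0 rho x0 W x tau gamma ->
  forall t, upto tau t -> 0 < x t - W t.
Proof.
intros Hx0 Hs t Ht.
assert (H0 : upto tau 0) by (apply upto_le with t; [split; [lra|apply Ht]|exact Ht]).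
destruct (proj1 Ht) as [Ht0|<-].
- apply (positive_from_right (fun s => x s - W s) x0); try assumption.
  + exact (sle0_gap_right0 _ _ _ _ _ _ Hs H0).
  + intros s Hst. apply (ex_derive_continuous (fun s => x s - W s)). eexists.
    apply (sle0_gap_derive _ _ _ _ _ _ Hs); [apply upto_le with t; [lra|exact Ht]|lra].
  + intros s Hst. apply (sle0_gap_neq0 _ _ _ _ _ _ Hs).
    apply upto_le with t; [lra|exact Ht].
- rewrite (proj2 (sle0_x_right0 _ _ _ _ _ _ Hs H0)), (sle0_W0 _ _ _ _ _ _ Hs). lra.
Qed.

(** For eps < d the set of times with gap eps is empty, so [gap_time] is [p_infty]. If tau were
    below [p_infty], the convergence in [sle0_tau] would make [gap_time] smaller than [p_infty] for
    all small eps. *)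
Lemma sle0_tau_infinite (rho x0 : R) (W x : R -> R) (tau : Rbar) (gamma : R -> C)
    (d : R) :
  0 < d -> chordal_SLE0 rho x0 W x tau gamma ->
  (forall t, upto tau t -> d <= Rabs (W t - x t)) -> tau = p_infty.
Proof.
intros Hd Hs Hgap.
assert (H : ~ Rbar_lt tau p_infty).
{ intros Hlt.
  destruct (proj2 (sle0_tau _ _ _ _ _ _ Hs) p_infty Hlt) as [e He].
  assert (He0 := cond_pos e).
  set (eps := Rmin (e / 2) (d / 2)).
  assert (H1 : eps <= e / 2) by apply Rmin_l.
  assert (H2 : eps <= d / 2) by apply Rmin_r.
  assert (H3 : 0 < eps) by (apply Rmin_pos; lra).
  specialize (He eps).
  assert (Hb : ball 0 e eps) by (change (Rabs (eps - 0) < e); rewrite Rabs_pos_eq; lra).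
  specialize (He Hb H3). unfold gap_time in He.
  set (E := fun t : R => upto tau t /\ Rabs (W t - x t) = eps) in He.
  assert (Hi := Glb_Rbar_correct E).
  apply (Rbar_lt_not_le _ _ He). apply (proj2 Hi).
  intros t [Ht1 Ht2]. exfalso. specialize (Hgap t Ht1). lra. }
destruct tau; try reflexivity; elim H; exact I.
Qed.

Lemma sle0_lifetime_infinite (rho x0 : R) (W x : R -> R) (tau : Rbar)
    (gamma : R -> C) :
  0 < x0 -> chordal_SLE0 rho x0 W x tau gamma -> -2 <= rho -> tau = p_infty.
Proof.
intros Hx0 Hs Hr.
apply (sle0_tau_infinite _ _ _ _ _ _ x0 Hx0 Hs).
intros t Ht.
assert (H := sle0_gap_sqr _ _ _ _ _ _ Hs t Ht).
assert (H1 := sle0_gap_pos _ _ _ _ _ _ Hx0 Hs t Ht).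
rewrite Rabs_minus_sym, Rabs_pos_eq by lra.
assert (H2 : 0 <= t) by apply Ht.
destruct (Rle_lt_dec x0 (x t - W t)) as [H3|H3]; [exact H3|nra].
Qed.

(** The candidate T is the zero of x0^2 + 2 (2 + rho) t. The lifetime cannot exceed T, because the
    gap would vanish there; if it were smaller than T, the gap would stay away from 0 and tau would
    be infinite. *)
Lemma sle0_lifetime_finite (rho x0 : R) (W x : R -> R) (tau : Rbar)
    (gamma : R -> C) :
  0 < x0 -> chordal_SLE0 rho x0 W x tau gamma -> rho < -2 ->
  tau = Finite (- (x0 ^ 2 / (2 * (2 + rho)))).
Proof.
intros Hx0 Hs Hr.
set (T := - (x0 ^ 2 / (2 * (2 + rho)))).
assert (HT : x0 ^ 2 + 2 * (2 + rho) * T = 0) by (unfold T; field; lra).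
assert (HT0 : 0 < T) by nra.
assert (Hle : Rbar_le tau T).
{ apply Rbar_not_lt_le. intros H.
  assert (Hu : upto tau T) by (split; [lra|exact H]).
  assert (H1 := sle0_gap_sqr _ _ _ _ _ _ Hs T Hu).
  assert (H2 := sle0_gap_pos _ _ _ _ _ _ Hx0 Hs T Hu). nra. }
apply Rbar_le_antisym; [exact Hle|].
apply Rbar_not_lt_le. intros Hlt.
(* A real bound on tau strictly below T; the value [m_infty] of tau is not excluded yet, and any
   real number below T serves for it. *)
assert (exists r : R, Rbar_le tau r /\ r < T) as [r [Hr1 Hr2]].
{ destruct tau as [r| |].
  - exists r. split; [apply Rbar_le_refl|exact Hlt].
  - elim Hlt.
  - exists (T - 1). split; [exact I|lra]. }
assert (Hp : 0 < x0 ^ 2 + 2 * (2 + rho) * r) by nra.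
assert (E : tau = p_infty).
{ apply (sle0_tau_infinite rho x0 W x tau gamma (sqrt (x0 ^ 2 + 2 * (2 + rho) * r)));
    [apply sqrt_lt_R0, Hp|exact Hs|].
  intros t Ht.
  assert (H := sle0_gap_sqr _ _ _ _ _ _ Hs t Ht).
  rewrite <- sqrt_Rsqr_abs. apply sqrt_le_1_alt.
  assert (Htr : t < r) by (exact (Rbar_lt_le_trans t tau r (proj2 Ht) Hr1)).
  unfold Rsqr. nra. }
rewrite E in Hle. exact Hle.
Qed.

Lemma Cminus_RtoC (z : C) (a : R) : (z - RtoC a)%C = (Re z - a, Im z).
Proof. apply injective_projections; simpl; [reflexivity|unfold Im; ring]. Qed.

Lemma Im_minus_RtoC (z : C) (a : R) : Im (z - RtoC a)%C = Im z.
Proof. rewrite Cminus_RtoC. reflexivity. Qed.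

Lemma filterlim_C_pair {T : Type} (F : (T -> Prop) -> Prop) {FF : Filter F}
    (f g : T -> R) (a b : R) :
  filterlim f F (locally a) -> filterlim g F (locally b) ->
  filterlim (fun t => (f t, g t) : C) F (locally ((a, b) : C)).
Proof.
intros Hf Hg P [d Hd]. unfold filtermap.
generalize (filter_and (fun t => ball a d (f t)) (fun t => ball b d (g t))
  (Hf _ (locally_ball a d)) (Hg _ (locally_ball b d))).
apply filter_imp; intros t [H1 H2]. apply Hd. split; assumption.
Qed.

(** * Loewner trajectories and conserved quantities *)

Lemma loewner_speed_components (z : C) (w : R) :
  z <> RtoC w ->
  0 < (Re z - w) ^ 2 + Im z ^ 2 /\
  Re (2 / (z - w))%C = 2 * (Re z - w) / ((Re z - w) ^ 2 + Im z ^ 2) /\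
  Im (2 / (z - w))%C = - 2 * Im z / ((Re z - w) ^ 2 + Im z ^ 2).
Proof.
intros Hz.
assert (H : 0 < (Re z - w) ^ 2 + Im z ^ 2).
{ destruct (Req_dec (Re z - w) 0) as [H1|H1]; [|assert (H2 := pow2_gt_0 _ H1); nra].
  destruct (Req_dec (Im z) 0) as [H2|H2]; [|assert (H3 := pow2_gt_0 _ H2); nra].
  elim Hz. apply injective_projections; simpl; [unfold Re in H1; lra|exact H2]. }
split; [exact H|].
rewrite Cminus_RtoC. set (a := Re z - w) in *; set (b := Im z) in *.
unfold Cdiv, Cinv, Cmult, RtoC, Re, Im; simpl.
simpl in H. split; field; lra.
Qed.

(** The two values are the real and imaginary parts of -2 / ((c - W)(u - W)), with N = |u - W|^2. *)
Lemma loewner_log_derivative (W : R -> R) (S : Rbar) (z : C) (u : R -> C)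
    (c : R -> R) (s : R) :
  loewner_trajectory W S z u -> upto S s -> 0 < s -> 0 < Im (u s) ->
  c s <> W s -> is_derive c s (2 / (c s - W s)) ->
  let N := (Re (u s) - W s) ^ 2 + Im (u s) ^ 2 in
  is_derive (fun r => ln (Cmod (u r - c r)%C)) s
    (- 2 / (c s - W s) * ((Re (u s) - W s) / N)) /\
  is_derive (fun r => Carg (u r - c r)%C) s
    (2 / (c s - W s) * (Im (u s) / N)).
Proof.
intros [_ [_ [Hn Hd]]] Hu Hs HI Hc Dc N.
destruct (is_derive_C _ _ _ (Hd s Hu Hs)) as [D1 D2].
destruct (loewner_speed_components (u s) (W s) (Hn s Hu)) as [HN [E1 E2]].
fold N in HN, E1, E2. rewrite E1 in D1. rewrite E2 in D2.
assert (Da : is_derive (fun r => Re (u r) - c r) s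
    (2 * (Re (u s) - W s) / N - 2 / (c s - W s)))
  by exact (is_derive_minus _ _ _ _ _ D1 Dc).
assert (Ea : 2 * (Re (u s) - W s) / N - 2 / (c s - W s) =
  (Re (u s) - c s) * (- 2 / (c s - W s) * ((Re (u s) - W s) / N))
  - Im (u s) * (2 / (c s - W s) * (Im (u s) / N))).
{ apply Rmult_eq_reg_r with N; [|lra].
  transitivity (2 * (Re (u s) - W s) - 2 / (c s - W s) * N); [field; lra|].
  unfold N at 1. field; lra. }
assert (Eb : - 2 * Im (u s) / N =
  (Re (u s) - c s) * (2 / (c s - W s) * (Im (u s) / N))
  + Im (u s) * (- 2 / (c s - W s) * ((Re (u s) - W s) / N))) by (field; lra).
rewrite Ea in Da. rewrite Eb in D2.
destruct (log_derivative (fun r => Re (u r) - c r) (fun r => Im (u r)) s _ _ HI Da D2)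
  as [H1 H2].
split.
- revert H1; apply is_derive_ext; intros r. rewrite Cminus_RtoC. reflexivity.
- revert H2; apply is_derive_ext; intros r. rewrite Cminus_RtoC. reflexivity.
Qed.

Lemma loewner_trajectory_right0 (W : R -> R) (S : Rbar) (z : C) (u : R -> C) :
  upto S 0 -> loewner_trajectory W S z u -> filterlim u (at_right 0) (locally z).
Proof.
intros H0 [E [Hc _]]. rewrite <- E. exact (continuous_on_right0 S u H0 Hc).
Qed.

(* [Im u] decreases in absolute value, so it cannot have vanished before t. *)
Lemma loewner_trajectory_upper (W : R -> R) (S : Rbar) (z : C) (u : R -> C) (t : R) :
  loewner_trajectory W S z u -> halfplane z -> upto S t -> 0 < Im (u t) ->
  forall s, 0 < s <= t -> 0 < Im (u s).
Proof.
intros Hu Hz Ht HI s Hs.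
assert (H0 : upto S 0) by (apply upto_le with t; [lra|exact Ht]).
assert (D : forall r, 0 < r <= t -> 0 < (Re (u r) - W r) ^ 2 + Im (u r) ^ 2 /\
  is_derive (fun q => Im (u q)) r
    (- 2 * Im (u r) / ((Re (u r) - W r) ^ 2 + Im (u r) ^ 2))).
{ intros r Hr. destruct Hu as [_ [_ [Hn Hd]]].
  assert (Hr' : upto S r) by (apply upto_le with t; [lra|exact Ht]).
  destruct (loewner_speed_components (u r) (W r) (Hn r Hr')) as [HN [_ E]].
  split; [exact HN|]. rewrite <- E.
  apply (is_derive_C u r), Hd; [exact Hr'|apply Hr]. }
(* The sign of [Im u] is what has to be found, so its square is used: the derivative of the square
   is -4 (Im u)^2 / |u - W|^2 <= 0. *)
assert (Hsq : forall r, 0 < r <= t -> Im (u t) ^ 2 <= Im (u r) ^ 2).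
{ intros r [Hr1 Hr2]. destruct Hr2 as [Hr2|Hr2]; [|rewrite Hr2; lra].
  destruct (MVT_cor2 (fun q => Im (u q) ^ 2)
    (fun q => 2 * (- 2 * Im (u q) / ((Re (u q) - W q) ^ 2 + Im (u q) ^ 2)) * Im (u q)) r t Hr2)
    as [q [Hq1 Hq2]].
  - intros q Hq. apply is_derive_Reals.
    destruct (D q) as [HN Dq]; [lra|].
    assert (E := is_derive_pow (fun q => Im (u q)) 2 q _ Dq).
    simpl pred in E. rewrite pow_1 in E.
    replace (INR 2) with 2 in E by (simpl; ring). exact E.
  - destruct (D q) as [HN _]; [lra|].
    assert (0 <= Im (u q) ^ 2 / ((Re (u q) - W q) ^ 2 + Im (u q) ^ 2) * (t - r)).
    { apply Rmult_le_pos; [|lra]. apply Rdiv_le_0_compat; [apply pow2_ge_0|exact HN]. }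
    assert (E : 2 * (- 2 * Im (u q) / ((Re (u q) - W q) ^ 2 + Im (u q) ^ 2)) *
       Im (u q) * (t - r) =
       - (4 * (Im (u q) ^ 2 / ((Re (u q) - W q) ^ 2 + Im (u q) ^ 2) * (t - r))))
      by (field; lra).
    rewrite E in Hq1. lra. }
apply (positive_from_right (fun r => Im (u r)) (Im z)); try apply Hs; try exact Hz.
- apply filterlim_Im; [apply at_right_proper_filter|].
  exact (loewner_trajectory_right0 W S z u H0 Hu).
- intros r Hr. apply (ex_derive_continuous (fun q => Im (u q))).
  eexists; apply D; lra.
- intros r Hr E. specialize (Hsq r). rewrite E in Hsq.
  assert (0 < r <= t) by lra. specialize (Hsq H). nra.
Qed.

Lemma filterlim_Cminus_RtoC {T : Type} (F : (T -> Prop) -> Prop) {FF : Filter F}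
    (u : T -> C) (c : T -> R) (z : C) (a : R) :
  filterlim u F (locally z) -> filterlim c F (locally a) ->
  filterlim (fun t => u t - c t)%C F (locally (z - a)%C).
Proof.
intros Hu Hc. rewrite Cminus_RtoC.
apply filterlim_ext with (fun t => (Re (u t) - c t, Im (u t)) : C).
{ intros t. rewrite Cminus_RtoC. reflexivity. }
apply filterlim_C_pair; [exact FF| |apply filterlim_Im; assumption].
apply filterlim_ext with (fun t => 1 * Re (u t) + -1 * c t); [intros; ring|].
replace (Re z - a) with (1 * Re z + -1 * a) by ring.
apply filterlim_lin2; try assumption. apply filterlim_Re; assumption.
Qed.

Lemma upper_neq_real (z : C) (a : R) : 0 < Im z -> (z - RtoC a)%C <> 0%C.
Proof.
intros H E. rewrite Cminus_RtoC in E. injection E. intros H1 _. unfold Im in *. lra.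
Qed.

Lemma filterlim_log_trajectory (W : R -> R) (S : Rbar) (z : C) (u : R -> C) (t : R)
    (c : R -> R) (a : R) :
  loewner_trajectory W S z u -> halfplane z -> upto S t -> 0 < Im (u t) -> 0 < t ->
  filterlim c (at_right 0) (locally a) ->
  filterlim (fun s => ln (Cmod (u s - c s)%C)) (at_right 0)
    (locally (ln (Cmod (z - a)%C))) /\
  filterlim (fun s => Carg (u s - c s)%C) (at_right 0)
    (locally (Carg (z - a)%C)).
Proof.
intros Hu Hz Ht HI Ht0 Hc.
assert (H0 : upto S 0) by (apply upto_le with t; [lra|exact Ht]).
assert (Hl := filterlim_Cminus_RtoC (at_right 0) u c z a
  (loewner_trajectory_right0 W S z u H0 Hu) Hc).
split.
- apply filterlim_ln_Cmod; [apply at_right_proper_filter| |exact Hl].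
  apply upper_neq_real, Hz.
- apply filterlim_Carg; [apply at_right_proper_filter| | | |exact Hl].
  + apply upper_neq_real, Hz.
  + rewrite Im_minus_RtoC. apply Rlt_le, Hz.
  + exists (mkposreal t Ht0). intros s Hs Hs0. rewrite Im_minus_RtoC.
    apply Rlt_le, (loewner_trajectory_upper W S z u t Hu Hz Ht HI).
    change (Rabs (s - 0) < t) in Hs. apply Rabs_def2 in Hs. lra.
Qed.

Lemma upto_Rbar_le (S T : Rbar) (t : R) : Rbar_le S T -> upto S t -> upto T t.
Proof. intros H [H1 H2]; split; [exact H1|exact (Rbar_lt_le_trans _ _ _ H2 H)]. Qed.

Lemma filterlim_at_right_eq (f g : R -> R) (a l m : R) :
  (forall y, a < y -> f y = g y) ->
  filterlim f (at_right a) (locally l) -> filterlim g (at_right a) (locally m) ->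
  l = m.
Proof.
intros H Hf Hg.
apply (filterlim_locally_unique (F := at_right a) f); [exact Hf|].
apply filterlim_ext_loc with g; [|exact Hg].
unfold at_right, within. apply filter_forall. intros y Hy. symmetry; apply H, Hy.
Qed.

(* The image under the flow of the second zero [- 2 * x0 / (2 + rho)] of the
   product [(z - x0) ^ (2 + rho) * (z + 2 * x0 / (2 + rho)) ^ 2]. *)
Definition dual_point (rho : R) (W x : R -> R) (t : R) : R :=
  W t - 2 / (2 + rho) * (x t - W t).

(** With D = x - W, both sides are -(2 + rho) / D: on the left W' = -rho / D and D' = (2 + rho) / D,
    on the right the distance to W is -2 D / (2 + rho). *)
Lemma dual_point_derive (rho x0 : R) (W x : R -> R) (tau : Rbar) (gamma : R -> C) :
  rho <> -2 -> chordal_SLE0 rho x0 W x tau gamma ->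
  forall t, upto tau t -> 0 < t ->
  is_derive (dual_point rho W x) t (2 / (dual_point rho W x t - W t)).
Proof.
intros Hr Hs t Ht Ht0.
assert (H := sle0_gap_neq0 _ _ _ _ _ _ Hs t Ht).
assert (D1 := sle0_W_ode _ _ _ _ _ _ Hs t Ht Ht0).
assert (D2 := sle0_gap_derive _ _ _ _ _ _ Hs t Ht Ht0).
assert (D : is_derive (dual_point rho W x) t
  (rho / (W t - x t) - 2 / (2 + rho) * ((2 + rho) / (x t - W t)))).
{ unfold dual_point. apply (is_derive_minus W); [exact D1|].
  apply (is_derive_scal (fun s => x s - W s)). exact D2. }
replace (2 / (dual_point rho W x t - W t)) with
  (rho / (W t - x t) - 2 / (2 + rho) * ((2 + rho) / (x t - W t))); [exact D|].
unfold dual_point. field. lra.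
Qed.

Lemma dual_point_right0 (rho x0 : R) (W x : R -> R) (tau : Rbar) (gamma : R -> C) :
  chordal_SLE0 rho x0 W x tau gamma -> upto tau 0 ->
  filterlim (dual_point rho W x) (at_right 0) (locally (- 2 / (2 + rho) * x0)).
Proof.
intros Hs H0.
apply filterlim_ext with (fun t => 1 * W t + - 2 / (2 + rho) * (x t - W t)).
{ intros t; unfold dual_point, Rdiv; ring. }
replace (- 2 / (2 + rho) * x0) with (1 * 0 + - 2 / (2 + rho) * x0) by ring.
apply filterlim_lin2; [apply at_right_proper_filter| |].
- exact (sle0_W_right0 _ _ _ _ _ _ Hs H0).
- exact (sle0_gap_right0 _ _ _ _ _ _ Hs H0).
Qed.

Lemma loewner_trajectory_at0 (W : R -> R) (S : Rbar) (z : C) (u : R -> C) :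
  loewner_trajectory W S z u -> u 0 = z.
Proof. intros [H _]; exact H. Qed.

(** The logarithmic derivatives of u - x and of u - [dual_point] are -2 / (u - W) multiplied by 1 /
    D and by -(2 + rho) / (2 D). The weights 2 + rho and 2 make them cancel. *)
Lemma sle0_conserved (rho x0 : R) (W x : R -> R) (tau : Rbar) (gamma : R -> C)
    (S : Rbar) (z : C) (u : R -> C) (t : R) :
  rho <> -2 -> chordal_SLE0 rho x0 W x tau gamma -> Rbar_le S tau ->
  loewner_trajectory W S z u -> halfplane z -> upto S t -> 0 < Im (u t) ->
  ((2 + rho) * ln (Cmod (u t - x t)%C) + 2 * ln (Cmod (u t - dual_point rho W x t)%C) =
   (2 + rho) * ln (Cmod (z - x0)%C) + 2 * ln (Cmod (z - (- 2 / (2 + rho) * x0)%R)%C)) /\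
  ((2 + rho) * Carg (u t - x t)%C + 2 * Carg (u t - dual_point rho W x t)%C =
   (2 + rho) * Carg (z - x0)%C + 2 * Carg (z - (- 2 / (2 + rho) * x0)%R)%C).
Proof.
intros Hr Hs HS Hu Hz Ht HI.
assert (H0 : upto tau 0).
{ apply upto_le with t; [split; [lra|apply Ht]|exact (upto_Rbar_le _ _ _ HS Ht)]. }
destruct (sle0_x_right0 _ _ _ _ _ _ Hs H0) as [Lx Ex].
assert (Ld := dual_point_right0 _ _ _ _ _ _ Hs H0).
assert (E0 : dual_point rho W x 0 = - 2 / (2 + rho) * x0).
{ unfold dual_point. rewrite Ex, (sle0_W0 _ _ _ _ _ _ Hs). unfold Rdiv; ring. }
assert (Eu := loewner_trajectory_at0 _ _ _ _ Hu).
destruct (proj1 Ht) as [Ht0|<-]; [|rewrite Eu, Ex, E0; split; reflexivity].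
destruct (filterlim_log_trajectory W S z u t x x0 Hu Hz Ht HI Ht0 Lx) as [L1 L2].
destruct (filterlim_log_trajectory W S z u t _ _ Hu Hz Ht HI Ht0 Ld) as [L3 L4].
assert (D : forall s, 0 < s <= t ->
  is_derive (fun r => (2 + rho) * ln (Cmod (u r - x r)%C) +
    2 * ln (Cmod (u r - dual_point rho W x r)%C)) s 0 /\
  is_derive (fun r => (2 + rho) * Carg (u r - x r)%C +
    2 * Carg (u r - dual_point rho W x r)%C) s 0).
{ intros s Hst.
  assert (HsS : upto S s) by (apply upto_le with t; [lra|exact Ht]).
  assert (Hst' : upto tau s) by exact (upto_Rbar_le _ _ _ HS HsS).
  assert (HD := sle0_gap_neq0 _ _ _ _ _ _ Hs s Hst').
  assert (Hd : dual_point rho W x s - W s = - 2 / (2 + rho) * (x s - W s)).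
  { unfold dual_point, Rdiv. ring. }
  assert (Hd0 : - 2 / (2 + rho) * (x s - W s) <> 0).
  { apply Rmult_integral_contrapositive_currified; [|exact HD].
    apply Rmult_integral_contrapositive_currified; [lra|].
    apply Rinv_neq_0_compat; lra. }
  assert (HIs := loewner_trajectory_upper _ _ _ _ _ Hu Hz Ht HI s Hst).
  destruct (loewner_log_derivative W S z u x s Hu HsS (proj1 Hst) HIs)
    as [A1 A2]; [lra|exact (sle0_x_derive _ _ _ _ _ _ Hs s Hst' (proj1 Hst))|].
  destruct (loewner_log_derivative W S z u (dual_point rho W x) s Hu HsS (proj1 Hst) HIs)
    as [A3 A4];
    [lra|exact (dual_point_derive _ _ _ _ _ _ Hr Hs s Hst' (proj1 Hst))|].
  rewrite Hd in A3, A4.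
  set (q1 := (Re (u s) - W s) / _) in A1, A3.
  set (q2 := Im (u s) / _) in A2, A4.
  split.
  - replace 0 with ((2 + rho) * (- 2 / (x s - W s) * q1) +
      2 * (- 2 / (- 2 / (2 + rho) * (x s - W s)) * q1)) by (field; lra).
    apply (is_derive_plus (fun r => (2 + rho) * ln (Cmod (u r - x r)%C))
       (fun r => 2 * ln (Cmod (u r - dual_point rho W x r)%C))).
    + exact (is_derive_scal _ _ (2 + rho) _ A1).
    + exact (is_derive_scal _ _ 2 _ A3).
  - replace 0 with ((2 + rho) * (2 / (x s - W s) * q2) +
      2 * (2 / (- 2 / (2 + rho) * (x s - W s)) * q2)) by (field; lra).
    apply (is_derive_plus (fun r => (2 + rho) * Carg (u r - x r)%C)
       (fun r => 2 * Carg (u r - dual_point rho W x r)%C)).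
    + exact (is_derive_scal _ _ (2 + rho) _ A2).
    + exact (is_derive_scal _ _ 2 _ A4). }
rewrite <- E0. rewrite <- E0 in L3, L4. rewrite <- Ex in L1, L2. rewrite <- Eu in L1, L2, L3, L4.
rewrite <- Ex, <- Eu.
split.
- apply (constant_from_right (fun r => (2 + rho) * ln (Cmod (u r - x r)%C) +
    2 * ln (Cmod (u r - dual_point rho W x r)%C))).
  + lra.
  + intros s Hst; apply D, Hst.
  + apply filterlim_lin2; try assumption. apply at_right_proper_filter.
- apply (constant_from_right (fun r => (2 + rho) * Carg (u r - x r)%C +
    2 * Carg (u r - dual_point rho W x r)%C)).
  + lra.
  + intros s Hst; apply D, Hst.
  + apply filterlim_lin2; try assumption. apply at_right_proper_filter.
Qed.

(** The gap stays equal to x0, so x0 times the logarithmic derivative of u - x is -2 / (u - W), the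
    opposite of u'. *)
Lemma sle0_conserved_rho_m2 (x0 : R) (W x : R -> R) (tau : Rbar) (gamma : R -> C)
    (S : Rbar) (z : C) (u : R -> C) (t : R) :
  0 < x0 -> chordal_SLE0 (-2) x0 W x tau gamma -> Rbar_le S tau ->
  loewner_trajectory W S z u -> halfplane z -> upto S t -> 0 < Im (u t) ->
  (Re (u t) + x0 * ln (Cmod (u t - x t)%C) = Re z + x0 * ln (Cmod (z - x0)%C)) /\
  (Im (u t) + x0 * Carg (u t - x t)%C = Im z + x0 * Carg (z - x0)%C).
Proof.
intros Hx0 Hs HS Hu Hz Ht HI.
assert (H0 : upto tau 0).
{ apply upto_le with t; [split; [lra|apply Ht]|exact (upto_Rbar_le _ _ _ HS Ht)]. }
destruct (sle0_x_right0 _ _ _ _ _ _ Hs H0) as [Lx Ex].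
assert (Eu := loewner_trajectory_at0 _ _ _ _ Hu).
destruct (proj1 Ht) as [Ht0|<-]; [|rewrite Eu, Ex; split; reflexivity].
assert (H0' : upto S 0) by (apply upto_le with t; [lra|exact Ht]).
destruct (filterlim_log_trajectory W S z u t x x0 Hu Hz Ht HI Ht0 Lx) as [L1 L2].
assert (Lu := loewner_trajectory_right0 W S z u H0' Hu).
assert (D : forall s, 0 < s <= t ->
  is_derive (fun r => 1 * Re (u r) + x0 * ln (Cmod (u r - x r)%C)) s 0 /\
  is_derive (fun r => 1 * Im (u r) + x0 * Carg (u r - x r)%C) s 0).
{ intros s Hst.
  assert (HsS : upto S s) by (apply upto_le with t; [lra|exact Ht]).
  assert (Hst' : upto tau s) by exact (upto_Rbar_le _ _ _ HS HsS).
  assert (HD : x s - W s = x0).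
  { assert (H1 := sle0_gap_sqr _ _ _ _ _ _ Hs s Hst').
    assert (H2 := sle0_gap_pos _ _ _ _ _ _ Hx0 Hs s Hst'). nra. }
  assert (HIs := loewner_trajectory_upper _ _ _ _ _ Hu Hz Ht HI s Hst).
  destruct (loewner_log_derivative W S z u x s Hu HsS (proj1 Hst) HIs)
    as [A1 A2]; [lra|exact (sle0_x_derive _ _ _ _ _ _ Hs s Hst' (proj1 Hst))|].
  assert (Hu' := Hu). destruct Hu' as [_ [_ [Hn Hd]]].
  destruct (is_derive_C _ _ _ (Hd s HsS (proj1 Hst))) as [D1 D2].
  destruct (loewner_speed_components (u s) (W s) (Hn s HsS)) as [HN [E1 E2]].
  rewrite E1 in D1. rewrite E2 in D2. rewrite HD in A1, A2.
  set (N := _ + _ ^ 2) in HN, D1, D2, A1, A2.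
  split.
  - replace 0 with (1 * (2 * (Re (u s) - W s) / N) +
      x0 * (- 2 / x0 * ((Re (u s) - W s) / N))) by (field; lra).
    apply (is_derive_plus (fun r => 1 * Re (u r)) (fun r => x0 * ln (Cmod (u r - x r)%C))).
    + exact (is_derive_scal _ _ 1 _ D1).
    + exact (is_derive_scal _ _ x0 _ A1).
  - replace 0 with (1 * (- 2 * Im (u s) / N) + x0 * (2 / x0 * (Im (u s) / N)))
      by (field; lra).
    apply (is_derive_plus (fun r => 1 * Im (u r)) (fun r => x0 * Carg (u r - x r)%C)).
    + exact (is_derive_scal _ _ 1 _ D2).
    + exact (is_derive_scal _ _ x0 _ A2). }
rewrite <- Ex in L1, L2. rewrite <- Eu in L1, L2, Lu.
split.
- assert (H : 1 * Re (u t) + x0 * ln (Cmod (u t - x t)%C) =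
    1 * Re (u 0) + x0 * ln (Cmod (u 0 - x 0)%C)); [|rewrite Eu, Ex in H; lra].
  apply (constant_from_right (fun r => 1 * Re (u r) + x0 * ln (Cmod (u r - x r)%C))).
  + lra.
  + intros s Hst; apply D, Hst.
  + apply filterlim_lin2; try assumption; try apply at_right_proper_filter.
    apply filterlim_Re; [apply at_right_proper_filter|exact Lu].
- assert (H : 1 * Im (u t) + x0 * Carg (u t - x t)%C =
    1 * Im (u 0) + x0 * Carg (u 0 - x 0)%C); [|rewrite Eu, Ex in H; lra].
  apply (constant_from_right (fun r => 1 * Im (u r) + x0 * Carg (u r - x r)%C)).
  + lra.
  + intros s Hst; apply D, Hst.
  + apply filterlim_lin2; try assumption; try apply at_right_proper_filter.
    apply filterlim_Im; [apply at_right_proper_filter|exact Lu].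
Qed.

(** The quotients are the real part of 1/z and the opposite of its imaginary part. *)
Lemma filterlim_div_Cmod_sqr {T : Type} (F : (T -> Prop) -> Prop) {FF : Filter F}
    (f : T -> C) (z : C) :
  z <> 0%C -> filterlim f F (locally z) ->
  filterlim (fun t => Re (f t) / Cmod (f t) ^ 2) F (locally (Re z / Cmod z ^ 2)) /\
  filterlim (fun t => Im (f t) / Cmod (f t) ^ 2) F (locally (Im z / Cmod z ^ 2)).
Proof.
intros Hz Hf.
assert (HN : 0 < Cmod z) by (apply Cmod_gt_0, Hz).
assert (LN : filterlim (fun t => / Cmod (f t) ^ 2) F (locally (/ Cmod z ^ 2))).
{ apply (filterlim_comp _ _ _ (fun t => Cmod (f t)) (fun r => / r ^ 2) F (locally (Cmod z))).
  - apply filterlim_Cmod; assumption.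
  - apply (ex_derive_continuous (fun r => / r ^ 2)). auto_derive. nra. }
split.
- apply (filterlim_comp_2 (G := locally (Re z)) (H := locally (/ Cmod z ^ 2))
    (fun t => Re (f t)) (fun t => / Cmod (f t) ^ 2) Rmult).
  + apply filterlim_Re; assumption.
  + exact LN.
  + apply (filterlim_mult (Re z) (/ Cmod z ^ 2)).
- apply (filterlim_comp_2 (G := locally (Im z)) (H := locally (/ Cmod z ^ 2))
    (fun t => Im (f t)) (fun t => / Cmod (f t) ^ 2) Rmult).
  + apply filterlim_Im; assumption.
  + exact LN.
  + apply (filterlim_mult (Im z) (/ Cmod z ^ 2)).
Qed.

Lemma filterlim_mult_R {T : Type} (F : (T -> Prop) -> Prop) {FF : Filter F}
    (f g : T -> R) (l m : R) :
  filterlim f F (locally l) -> filterlim g F (locally m) ->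
  filterlim (fun t => f t * g t) F (locally (l * m)).
Proof.
intros Hf Hg.
apply (filterlim_comp_2 (G := locally l) (H := locally m) f g Rmult Hf Hg).
apply (filterlim_mult l m).
Qed.

(** The term D / (u - x) has the same derivative as log (u - x), namely -2 / (D (u - W)): use D' =
    -2 / D and u - W = (u - x) + D. The plus sign in the second identity comes from Im (1/z) = - Im
    z / |z|^2. *)
Lemma sle0_conserved_rho_m4 (x0 : R) (W x : R -> R) (tau : Rbar) (gamma : R -> C)
    (S : Rbar) (z : C) (u : R -> C) (t : R) :
  chordal_SLE0 (-4) x0 W x tau gamma -> Rbar_le S tau ->
  loewner_trajectory W S z u -> halfplane z -> upto S t -> 0 < Im (u t) ->
  (ln (Cmod (u t - x t)%C) - (x t - W t) * (Re (u t - x t)%C / Cmod (u t - x t)%C ^ 2) =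
   ln (Cmod (z - x0)%C) - x0 * (Re (z - x0)%C / Cmod (z - x0)%C ^ 2)) /\
  (Carg (u t - x t)%C + (x t - W t) * (Im (u t - x t)%C / Cmod (u t - x t)%C ^ 2) =
   Carg (z - x0)%C + x0 * (Im (z - x0)%C / Cmod (z - x0)%C ^ 2)).
Proof.
intros Hs HS Hu Hz Ht HI.
assert (H0 : upto tau 0).
{ apply upto_le with t; [split; [lra|apply Ht]|exact (upto_Rbar_le _ _ _ HS Ht)]. }
destruct (sle0_x_right0 _ _ _ _ _ _ Hs H0) as [Lx Ex].
assert (EW := sle0_W0 _ _ _ _ _ _ Hs).
assert (Eu := loewner_trajectory_at0 _ _ _ _ Hu).
destruct (proj1 Ht) as [Ht0|<-]; [|rewrite Eu, Ex, EW, Rminus_0_r; split; reflexivity].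
assert (H0' : upto S 0) by (apply upto_le with t; [lra|exact Ht]).
destruct (filterlim_log_trajectory W S z u t x x0 Hu Hz Ht HI Ht0 Lx) as [L1 L2].
assert (Lu := loewner_trajectory_right0 W S z u H0' Hu).
assert (FR := at_right_proper_filter 0).
assert (LE := filterlim_Cminus_RtoC (at_right 0) u x z x0 Lu Lx).
destruct (filterlim_div_Cmod_sqr (at_right 0) _ _ (upper_neq_real z x0 Hz) LE) as [L3 L4].
assert (LD := sle0_gap_right0 _ _ _ _ _ _ Hs H0).
assert (L5 := filterlim_mult_R (at_right 0) _ _ _ _ LD L3).
assert (L6 := filterlim_mult_R (at_right 0) _ _ _ _ LD L4).
assert (D : forall s, 0 < s <= t ->
  is_derive (fun r => 1 * ln (Cmod (u r - x r)%C) +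
    -1 * ((x r - W r) * (Re (u r - x r)%C / Cmod (u r - x r)%C ^ 2))) s 0 /\
  is_derive (fun r => 1 * Carg (u r - x r)%C +
    1 * ((x r - W r) * (Im (u r - x r)%C / Cmod (u r - x r)%C ^ 2))) s 0).
{ intros s Hst.
  assert (HsS : upto S s) by (apply upto_le with t; [lra|exact Ht]).
  assert (Hst' : upto tau s) by exact (upto_Rbar_le _ _ _ HS HsS).
  assert (HD := sle0_gap_neq0 _ _ _ _ _ _ Hs s Hst').
  assert (HIs := loewner_trajectory_upper _ _ _ _ _ Hu Hz Ht HI s Hst).
  assert (Dx := sle0_x_derive _ _ _ _ _ _ Hs s Hst' (proj1 Hst)).
  assert (DD := sle0_gap_derive _ _ _ _ _ _ Hs s Hst' (proj1 Hst)).
  destruct (loewner_log_derivative W S z u x s Hu HsS (proj1 Hst) HIs)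
    as [A1 A2]; [lra|exact Dx|].
  assert (Hu' := Hu). destruct Hu' as [_ [_ [Hn Hd]]].
  destruct (is_derive_C _ _ _ (Hd s HsS (proj1 Hst))) as [D1 D2].
  destruct (loewner_speed_components (u s) (W s) (Hn s HsS)) as [HN [E1 E2]].
  rewrite E1 in D1. rewrite E2 in D2.
  assert (Da : is_derive (fun r => Re (u r) - x r) s
    (2 * (Re (u s) - W s) / ((Re (u s) - W s) ^ 2 + Im (u s) ^ 2) - 2 / (x s - W s)))
    by exact (is_derive_minus _ _ _ _ _ D1 Dx).
  assert (EN : forall r, Cmod (u r - x r)%C ^ 2 = (Re (u r) - x r) ^ 2 + Im (u r) ^ 2).
  { intros r. rewrite Cminus_RtoC. apply Cmod_pair_sqr. }
  set (a := fun r => Re (u r) - x r) in *.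
  set (b := fun r => Im (u r)) in *.
  set (d := fun r => x r - W r) in *.
  change (Im (u s)) with (b s) in *. change (x s - W s) with (d s) in *.
  replace (Re (u s) - W s) with (a s + d s) in * by (unfold a, d; ring).
  assert (Eda : Derive (fun r : R => a r) s = 2 * (a s + d s) / ((a s + d s) ^ 2 + b s ^ 2) - 2 / d s)
    by apply is_derive_unique, Da.
  assert (Edb : Derive (fun r : R => b r) s = - 2 * b s / ((a s + d s) ^ 2 + b s ^ 2))
    by apply is_derive_unique, D2.
  assert (Edd : Derive (fun r : R => d r) s = (2 + -4) / d s)
    by apply is_derive_unique, DD.
  assert (HM : 0 < a s ^ 2 + b s ^ 2) by nra.
  assert (G1 : is_derive (fun r => d r * (a r / (a r ^ 2 + b r ^ 2))) s
     (-2 / d s * ((a s + d s) / ((a s + d s) ^ 2 + b s ^ 2)))).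
  { auto_derive.
    - repeat split; try (eexists; eassumption). simpl in HM. lra.
    - rewrite Eda, Edb, Edd. field. simpl in HM; simpl in HN. repeat split; lra. }
  assert (G2 : is_derive (fun r => d r * (b r / (a r ^ 2 + b r ^ 2))) s
     (- (2 / d s * (b s / ((a s + d s) ^ 2 + b s ^ 2))))).
  { auto_derive.
    - repeat split; try (eexists; eassumption). simpl in HM. lra.
    - rewrite Eda, Edb, Edd. field. simpl in HM; simpl in HN. repeat split; lra. }
  split.
  - apply is_derive_ext with (fun r => ln (Cmod (u r - x r)%C) -
      d r * (a r / (a r ^ 2 + b r ^ 2))).
    { intros r. rewrite EN, Cminus_RtoC. unfold a, b, d. simpl Re.
      match goal with |- ?p = ?q => change (@eq R p q) end. ring. }
    assert (H := is_derive_minus _ _ _ _ _ A1 G1).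
    rewrite minus_eq_zero in H. exact H.
  - apply is_derive_ext with (fun r => Carg (u r - x r)%C +
      d r * (b r / (a r ^ 2 + b r ^ 2))).
    { intros r. rewrite EN, Cminus_RtoC. unfold a, b, d. simpl Im.
      match goal with |- ?p = ?q => change (@eq R p q) end. ring. }
    assert (H := is_derive_plus _ _ _ _ _ A2 G2).
    assert (H' := plus_opp_r (2 / d s * (b s / ((a s + d s) ^ 2 + b s ^ 2)) : R_AbelianGroup)).
    unfold opp in H'; simpl in H'. 
    replace 0 with (plus (2 / d s * (b s / ((a s + d s) ^ 2 + b s ^ 2)))
      (- (2 / d s * (b s / ((a s + d s) ^ 2 + b s ^ 2))))) by exact H'.
    exact H. }
split.
- assert (H : 1 * ln (Cmod (u t - x t)%C) +
    -1 * ((x t - W t) * (Re (u t - x t)%C / Cmod (u t - x t)%C ^ 2)) =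
    1 * ln (Cmod (u 0 - x 0)%C) +
    -1 * ((x 0 - W 0) * (Re (u 0 - x 0)%C / Cmod (u 0 - x 0)%C ^ 2)));
    [|rewrite Eu, Ex, EW, Rminus_0_r in H; lra].
  apply (constant_from_right (fun r => 1 * ln (Cmod (u r - x r)%C) +
    -1 * ((x r - W r) * (Re (u r - x r)%C / Cmod (u r - x r)%C ^ 2)))).
  + lra.
  + intros s Hst; apply D, Hst.
  + rewrite Eu, Ex, EW, Rminus_0_r. apply filterlim_lin2; assumption || exact _.
- assert (H : 1 * Carg (u t - x t)%C +
    1 * ((x t - W t) * (Im (u t - x t)%C / Cmod (u t - x t)%C ^ 2)) =
    1 * Carg (u 0 - x 0)%C +
    1 * ((x 0 - W 0) * (Im (u 0 - x 0)%C / Cmod (u 0 - x 0)%C ^ 2)));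
    [|rewrite Eu, Ex, EW, Rminus_0_r in H; lra].
  apply (constant_from_right (fun r => 1 * Carg (u r - x r)%C +
    1 * ((x r - W r) * (Im (u r - x r)%C / Cmod (u r - x r)%C ^ 2)))).
  + lra.
  + intros s Hst; apply D, Hst.
  + rewrite Eu, Ex, EW, Rminus_0_r. apply filterlim_lin2; assumption || exact _.
Qed.

(** * Equations of the curve *)

(** Exponentiating, |f| tends to exp l > 0. The values of f must avoid 0 because [ln 0] is 0 by
    convention. *)
Lemma ln_Cmod_converges_neq0 {T : Type} (F : (T -> Prop) -> Prop) {FF : ProperFilter F}
    (f : T -> C) (z : C) (l : R) :
  F (fun t => f t <> 0%C) -> filterlim f F (locally z) ->
  filterlim (fun t => ln (Cmod (f t))) F (locally l) -> z <> 0%C.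
Proof.
intros Hn Hf Hl E. rewrite E in Hf.
assert (H1 := filterlim_Cmod F f 0%C Hf). rewrite Cmod_0 in H1.
assert (H2 : filterlim (fun t => exp (ln (Cmod (f t)))) F (locally (exp l))).
{ apply (filterlim_comp _ _ _ (fun t => ln (Cmod (f t))) exp F (locally l) _ Hl).
  apply (continuous_exp l). }
assert (H3 : filterlim (fun t => Cmod (f t)) F (locally (exp l))).
{ revert H2. apply filterlim_ext_loc. revert Hn; apply filter_imp; intros t Ht.
  apply exp_ln, Cmod_gt_0, Ht. }
assert (H4 : exp l = 0)
  by exact (filterlim_locally_unique (F := F) (fun t => Cmod (f t)) _ _ H3 H1).
assert (H5 := exp_pos l). lra.
Qed.

(** The boundary value of the argument on the real axis, seen from the upper half-plane; the value
    at 0 is junk. *)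
Definition arg_of_sign (r : R) : R := if Rlt_dec 0 r then 0 else PI.

Lemma Carg_real (r : R) : r <> 0 -> Carg (RtoC r) = arg_of_sign r.
Proof.
intros Hr. rewrite Carg_upper by (simpl; lra). rewrite Cmod_R. simpl Re.
unfold arg_of_sign. destruct (Rlt_dec 0 r).
- rewrite Rabs_pos_eq by lra. replace (r / r) with 1 by (field; exact Hr). apply acos_1.
- rewrite Rabs_left by lra. replace (r / - r) with (-(1)) by (field; exact Hr).
  rewrite acos_opp, acos_1. ring.
Qed.

Lemma filterlim_tip (w c : R) :
  filterlim (fun y : R => (w + Ci * y) - c)%C (at_right 0) (locally (RtoC (w - c))).
Proof.
apply filterlim_ext with (fun y : R => (w - c, y) : C).
{ intros y. apply injective_projections; simpl; ring. }
apply filterlim_C_pair; [apply at_right_proper_filter|apply filterlim_const|].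
intros P HP. unfold filtermap, at_right, within. revert HP. apply filter_imp; auto.
Qed.

Lemma filterlim_log_tip (w c : R) :
  w <> c ->
  filterlim (fun y : R => ln (Cmod ((w + Ci * y) - c)%C)) (at_right 0)
    (locally (ln (Rabs (w - c)))) /\
  filterlim (fun y : R => Carg ((w + Ci * y) - c)%C) (at_right 0)
    (locally (arg_of_sign (w - c))).
Proof.
intros H. assert (H' : w - c <> 0) by lra.
assert (FR := at_right_proper_filter 0).
assert (H0 : RtoC (w - c) <> 0%C) by (intros E; injection E; exact H').
split.
- rewrite <- Cmod_R. apply filterlim_ln_Cmod; [exact _|exact H0|apply filterlim_tip].
- rewrite <- Carg_real by exact H'.
  apply filterlim_Carg; [exact _|exact H0|simpl; lra| |apply filterlim_tip].
  unfold at_right, within. apply filter_forall. intros y Hy.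
  rewrite Im_minus_RtoC. simpl. lra.
Qed.

(* Points of the upper half-plane whose image under the flow at time t tends
   to the tip. *)
Lemma sle0_tip_sequence (rho x0 : R) (W x : R -> R) (tau : Rbar) (gamma : R -> C) (t : R) :
  chordal_SLE0 rho x0 W x tau gamma -> upto tau t ->
  exists h : R -> C,
    filterlim h (at_right 0) (locally (gamma t)) /\
    forall y, 0 < y -> 0 < Im (h y) /\
      exists (S : Rbar) (u : R -> C),
        Rbar_le S tau /\ upto S t /\ loewner_trajectory W S (h y) u /\
        u t = (W t + Ci * y)%C.
Proof.
intros Hs Ht.
destruct (sle0_gamma _ _ _ _ _ _ Hs t Ht) as [h [Hh Hl]].
exists (fun y => h (W t + Ci * y)%C). split; [exact Hl|].
intros y Hy.
assert (Hw : halfplane (W t + Ci * y)%C) by (unfold halfplane; simpl; lra).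
destruct (Hh _ Hw) as [H1 [S [u [H2 [H3 [H4 H5]]]]]].
split; [exact H1|]. exists S, u.
split; [exact H3|]. split; [split; [apply Ht|exact H2]|]. split; assumption.
Qed.

Lemma filterlim_Im_ge0 (h : R -> C) (z : C) :
  (forall y, 0 < y -> 0 < Im (h y)) -> filterlim h (at_right 0) (locally z) -> 0 <= Im z.
Proof.
intros Hh Hl. apply Rnot_lt_le; intros Hz.
assert (FR := at_right_proper_filter 0).
assert (L := filterlim_Im (at_right 0) h z Hl).
assert (P : locally (Im z) (fun r => r < 0)) by apply (open_lt 0 (Im z) Hz).
assert (Q : at_right 0 (fun y => Im (h y) < 0)) by exact (L _ P).
assert (Q' : at_right 0 (fun y => 0 < Im (h y))).
{ unfold at_right, within. apply filter_forall. exact Hh. }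
destruct (filter_ex _ (filter_and _ _ Q Q')) as [y Hy]. lra.
Qed.

Lemma at_right_forall (a : R) (P : R -> Prop) :
  (forall y, a < y -> P y) -> at_right a P.
Proof. intros H. unfold at_right, within. apply filter_forall, H. Qed.

(** Solving for the first logarithm: since ln |g| converges, ln |f| converges too, and the limit of
    f cannot be 0. *)
Lemma log_combination_neq0 {T : Type} (F : (T -> Prop) -> Prop) {FF : ProperFilter F}
    (f g : T -> C) (z w : C) (a b m : R) :
  a <> 0 -> F (fun t => f t <> 0%C) -> w <> 0%C ->
  filterlim f F (locally z) -> filterlim g F (locally w) ->
  filterlim (fun t => a * ln (Cmod (f t)) + b * ln (Cmod (g t))) F (locally m) ->
  z <> 0%C.
Proof.
intros Ha Hf Hw Lf Lg L.
apply (ln_Cmod_converges_neq0 F f z (/ a * m + - b / a * ln (Cmod w)) Hf Lf).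
apply filterlim_ext with (fun t =>
  / a * (a * ln (Cmod (f t)) + b * ln (Cmod (g t))) + - b / a * ln (Cmod (g t))).
{ intros t. match goal with |- ?p = ?q => change (@eq R p q) end. field; exact Ha. }
apply filterlim_lin2; [exact _|exact L|].
apply filterlim_ln_Cmod; [exact _|exact Hw|exact Lg].
Qed.

Lemma Cminus_eq0 (z w : C) : (z - w)%C = 0%C -> z = w.
Proof. intros H. replace z with (z - w + w)%C by ring. rewrite H. ring. Qed.

(** The conservation laws for the trajectories from [h y] to W_t + i y, in the limit y -> 0+. At the
    tip u - x becomes -D and u - [dual_point] becomes 2 D / (2 + rho), whence the right-hand sides.
    On the left, [gamma t] must avoid x0 and p: it cannot equal both, and if it equalled one of
    them, a single logarithm would diverge while the combination converges. *)
Lemma sle0_curve_equations (rho x0 : R) (W x : R -> R) (tau : Rbar) (gamma : R -> C)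
    (t : R) :
  let p := - 2 / (2 + rho) * x0 in
  0 < x0 -> rho <> -2 -> rho <> -4 ->
  chordal_SLE0 rho x0 W x tau gamma -> upto tau t ->
  0 <= Im (gamma t) /\ (gamma t - x0)%C <> 0%C /\ (gamma t - p)%C <> 0%C /\
  (2 + rho) * ln (Cmod (gamma t - x0)%C) + 2 * ln (Cmod (gamma t - p)%C) =
    (2 + rho) * ln (x t - W t) + 2 * ln (Rabs (2 / (2 + rho)) * (x t - W t)) /\
  (2 + rho) * Carg (gamma t - x0)%C + 2 * Carg (gamma t - p)%C =
    (2 + rho) * PI + 2 * arg_of_sign (2 / (2 + rho)).
Proof.
intros p Hx0 Hr2 Hr4 Hs Ht.
destruct (sle0_tip_sequence _ _ _ _ _ _ t Hs Ht) as [h [Lh Hh]].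
assert (FR := at_right_proper_filter 0).
assert (HIm : 0 <= Im (gamma t)).
{ apply (filterlim_Im_ge0 h); [intros y Hy; apply Hh, Hy|exact Lh]. }
assert (Eq : forall y, 0 < y ->
  (2 + rho) * ln (Cmod (h y - x0)%C) + 2 * ln (Cmod (h y - p)%C) =
  (2 + rho) * ln (Cmod (W t + Ci * y - x t)%C) +
    2 * ln (Cmod (W t + Ci * y - dual_point rho W x t)%C) /\
  (2 + rho) * Carg (h y - x0)%C + 2 * Carg (h y - p)%C =
  (2 + rho) * Carg (W t + Ci * y - x t)%C +
    2 * Carg (W t + Ci * y - dual_point rho W x t)%C).
{ intros y Hy. destruct (Hh y Hy) as [Hhy [S [u [HS [HtS [Hu Eu]]]]]].
  destruct (sle0_conserved rho x0 W x tau gamma S (h y) u t Hr2 Hs HS Hu Hhy HtS)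
    as [H1 H2].
  - rewrite Eu. simpl. lra.
  - rewrite Eu in H1, H2. split; symmetry; assumption. }
assert (HD := sle0_gap_pos _ _ _ _ _ _ Hx0 Hs t Ht).
assert (Ed : W t - dual_point rho W x t = 2 / (2 + rho) * (x t - W t))
  by (unfold dual_point; ring).
assert (Hk : 2 / (2 + rho) <> 0).
{ apply Rmult_integral_contrapositive_currified; [lra|].
  apply Rinv_neq_0_compat; lra. }
assert (Hd : W t <> dual_point rho W x t).
{ intros E. assert (E' : 2 / (2 + rho) * (x t - W t) = 0) by lra.
  apply Rmult_integral in E'. lra. }
destruct (filterlim_log_tip (W t) (x t)) as [T1 T2]; [lra|].
destruct (filterlim_log_tip (W t) (dual_point rho W x t) Hd) as [T3 T4].
rewrite Ed in T3, T4. rewrite Rabs_mult, (Rabs_pos_eq (x t - W t)) in T3 by lra.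
rewrite Rabs_minus_sym, Rabs_pos_eq in T1 by lra.
assert (Es1 : arg_of_sign (W t - x t) = PI).
{ unfold arg_of_sign. destruct (Rlt_dec 0 (W t - x t)); [lra|reflexivity]. }
assert (Es2 : arg_of_sign (2 / (2 + rho) * (x t - W t)) = arg_of_sign (2 / (2 + rho))).
{ unfold arg_of_sign.
  destruct (Rlt_dec 0 (2 / (2 + rho) * (x t - W t)));
  destruct (Rlt_dec 0 (2 / (2 + rho))); try reflexivity; exfalso; nra. }
rewrite Es1 in T2. rewrite Es2 in T4.
assert (L1 := filterlim_lin2 (at_right 0) _ _ (2 + rho) 2 _ _ T1 T3).
assert (L2 := filterlim_lin2 (at_right 0) _ _ (2 + rho) 2 _ _ T2 T4).
assert (Lx := filterlim_Cminus_const (at_right 0) h (gamma t) x0 Lh).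
assert (Lp := filterlim_Cminus_const (at_right 0) h (gamma t) p Lh).
assert (L1' : filterlim (fun y => (2 + rho) * ln (Cmod (h y - x0)%C) +
    2 * ln (Cmod (h y - p)%C)) (at_right 0)
    (locally ((2 + rho) * ln (x t - W t) + 2 * ln (Rabs (2 / (2 + rho)) * (x t - W t))))).
{ revert L1. apply filterlim_ext_loc, at_right_forall. intros y Hy. symmetry.
  apply (proj1 (Eq y Hy)). }
assert (Hneq : forall c : R, at_right 0 (fun y => (h y - c)%C <> 0%C)).
{ intros c. apply at_right_forall. intros y Hy. apply upper_neq_real, Hh, Hy. }
(* The two singular points coincide exactly when rho = -4. *)
assert (Hpx : p <> x0).
{ unfold p. intros E. assert (E' : (2 + rho) * (- 2 / (2 + rho) * x0) = (2 + rho) * x0)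
    by (rewrite E; ring).
  replace ((2 + rho) * (- 2 / (2 + rho) * x0)) with (- 2 * x0) in E' by (field; lra).
  assert (E2 : (rho + 4) * x0 = 0) by lra. apply Rmult_integral in E2. lra. }
assert (Hnot : (gamma t - x0)%C = 0%C -> (gamma t - p)%C = 0%C -> False).
{ intros E1 E2. apply Cminus_eq0 in E1. apply Cminus_eq0 in E2.
  rewrite E1 in E2. injection E2. intros E3. apply Hpx; symmetry; exact E3. }
assert (N1 : (gamma t - x0)%C <> 0%C).
{ intros E. apply (log_combination_neq0 (at_right 0) _ _ (gamma t - x0)%C (gamma t - p)%C
    (2 + rho) 2 _ ltac:(lra) (Hneq x0) (Hnot E) Lx Lp L1' E). }
assert (N2 : (gamma t - p)%C <> 0%C).
{ apply (log_combination_neq0 (at_right 0) (fun y : R => h y - p)%C (fun y : R => h y - x0)%C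
    _ (gamma t - x0)%C 2 (2 + rho)
    ((2 + rho) * ln (x t - W t) + 2 * ln (Rabs (2 / (2 + rho)) * (x t - W t)))
    ltac:(lra) (Hneq p) N1 Lp Lx).
  revert L1'. apply filterlim_ext. intros y.
  match goal with |- ?p = ?q => change (@eq R p q) end. ring. }
repeat split; try assumption.
- apply (filterlim_locally_unique (F := at_right 0) (fun y => (2 + rho) * ln (Cmod (h y - x0)%C) +
    2 * ln (Cmod (h y - p)%C))); [|exact L1'].
  apply filterlim_lin2; [exact _| |]; apply filterlim_ln_Cmod; assumption || exact _.
- refine (filterlim_at_right_eq _ _ 0 _ _ (fun y Hy => proj2 (Eq y Hy)) _ L2).
  apply filterlim_lin2; [exact _| |]; apply filterlim_Carg; try assumption; try exact _;
    try (rewrite Im_minus_RtoC; assumption);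
    apply at_right_forall; intros y Hy; rewrite Im_minus_RtoC; apply Rlt_le, Hh, Hy.
Qed.

Lemma sle0_rho_m2_driving (x0 : R) (W x : R -> R) (tau : Rbar) (gamma : R -> C) (t : R) :
  0 < x0 -> chordal_SLE0 (-2) x0 W x tau gamma -> upto tau t ->
  x t - W t = x0 /\ W t = 2 / x0 * t.
Proof.
intros Hx0 Hs Ht.
assert (HD : forall s, upto tau s -> x s - W s = x0).
{ intros s Hst.
  assert (H1 := sle0_gap_sqr _ _ _ _ _ _ Hs s Hst).
  assert (H2 := sle0_gap_pos _ _ _ _ _ _ Hx0 Hs s Hst). nra. }
split; [exact (HD t Ht)|].
assert (H0 : upto tau 0) by (apply upto_le with t; [split; [lra|apply Ht]|exact Ht]).
assert (HW := sle0_W0 _ _ _ _ _ _ Hs).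
assert (H : 1 * W t + - (2 / x0) * t = 1 * W 0 + - (2 / x0) * 0); [|rewrite HW in H; lra].
apply (constant_from_right (fun s => 1 * W s + - (2 / x0) * s)); [apply Ht| |].
- intros s Hst.
  assert (Hu : upto tau s) by (apply upto_le with t; [lra|exact Ht]).
  assert (D := sle0_W_ode _ _ _ _ _ _ Hs s Hu (proj1 Hst)).
  replace (-2 / (W s - x s)) with (2 / x0) in D 
    by (replace (W s - x s) with (- x0) by (rewrite <- (HD s Hu); ring); field; lra).
  replace 0 with (1 * (2 / x0) + - (2 / x0) * 1) by ring.
  apply (is_derive_plus (fun s => 1 * W s) (fun s => - (2 / x0) * s)).
  + apply (is_derive_scal W s 1 (2 / x0)), D.
  + apply (is_derive_scal (fun s => s) s (- (2 / x0)) 1), (is_derive_id s).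
- apply filterlim_lin2; [apply at_right_proper_filter| |].
  + rewrite HW. exact (sle0_W_right0 _ _ _ _ _ _ Hs H0).
  + intros P HP. unfold filtermap, at_right, within. revert HP. apply filter_imp; auto.
Qed.

Lemma sle0_rho_m2_curve_equations (x0 : R) (W x : R -> R) (tau : Rbar) (gamma : R -> C) (t : R) :
  0 < x0 -> chordal_SLE0 (-2) x0 W x tau gamma -> upto tau t ->
  0 <= Im (gamma t) /\ (gamma t - x0)%C <> 0%C /\
  Re (gamma t) + x0 * ln (Cmod (gamma t - x0)%C) = 2 / x0 * t + x0 * ln x0 /\
  Im (gamma t) + x0 * Carg (gamma t - x0)%C = x0 * PI.
Proof.
intros Hx0 Hs Ht.
destruct (sle0_tip_sequence _ _ _ _ _ _ t Hs Ht) as [h [Lh Hh]].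
destruct (sle0_rho_m2_driving _ _ _ _ _ t Hx0 Hs Ht) as [HD HW].
assert (FR := at_right_proper_filter 0).
assert (HIm : 0 <= Im (gamma t)).
{ apply (filterlim_Im_ge0 h); [intros y Hy; apply Hh, Hy|exact Lh]. }
assert (Eq : forall y, 0 < y ->
  1 * Re (h y) + x0 * ln (Cmod (h y - x0)%C) =
    1 * W t + x0 * ln (Cmod (W t + Ci * y - x t)%C) /\
  1 * Im (h y) + x0 * Carg (h y - x0)%C =
    1 * y + x0 * Carg (W t + Ci * y - x t)%C).
{ intros y Hy. destruct (Hh y Hy) as [Hhy [S [u [HS [HtS [Hu Eu]]]]]].
  destruct (sle0_conserved_rho_m2 x0 W x tau gamma S (h y) u t Hx0 Hs HS Hu Hhy HtS)
    as [H1 H2].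
  - rewrite Eu. simpl. lra.
  - rewrite Eu in H1, H2.
    replace (Re (W t + Ci * y)%C) with (W t) in H1 by (simpl; ring).
    replace (Im (W t + Ci * y)%C) with y in H2 by (simpl; ring).
    split; lra. }
destruct (filterlim_log_tip (W t) (x t)) as [T1 T2]; [lra|].
assert (Es1 : arg_of_sign (W t - x t) = PI).
{ unfold arg_of_sign. destruct (Rlt_dec 0 (W t - x t)); [lra|reflexivity]. }
rewrite Es1 in T2. rewrite Rabs_minus_sym, HD, Rabs_pos_eq in T1 by lra.
assert (Ly : filterlim (fun y : R => y) (at_right 0) (locally 0)).
{ intros P HP. unfold filtermap, at_right, within. revert HP. apply filter_imp; auto. }
assert (L1 := filterlim_lin2 (at_right 0) _ _ 1 x0 _ _ (filterlim_const (W t)) T1).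
assert (L2 := filterlim_lin2 (at_right 0) _ _ 1 x0 _ _ Ly T2).
assert (Lx := filterlim_Cminus_const (at_right 0) h (gamma t) x0 Lh).
assert (LRe := filterlim_Re (at_right 0) h (gamma t) Lh).
assert (LIm := filterlim_Im (at_right 0) h (gamma t) Lh).
(* [Re (h y)] has a finite limit, so the conserved real part makes ln |h y - x0| converge. *)
assert (N1 : (gamma t - x0)%C <> 0%C).
{ apply (ln_Cmod_converges_neq0 (at_right 0) (fun y : R => h y - x0)%C _
    (/ x0 * (1 * W t + x0 * ln x0) + - / x0 * Re (gamma t))); [|exact Lx|].
  - apply at_right_forall. intros y Hy. apply upper_neq_real, Hh, Hy.
  - apply filterlim_ext_loc with (fun y : R =>
      / x0 * (1 * W t + x0 * ln (Cmod (W t + Ci * y - x t)%C)) + - / x0 * Re (h y)).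
    + apply at_right_forall. intros y Hy. rewrite <- (proj1 (Eq y Hy)). field. lra.
    + apply filterlim_lin2; [exact _|exact L1|exact LRe]. }
split; [exact HIm|]. split; [exact N1|]. split.
- rewrite <- HW. rewrite <- (Rmult_1_l (Re (gamma t))), <- (Rmult_1_l (W t)).
  refine (filterlim_at_right_eq
    (fun y => 1 * Re (h y) + x0 * ln (Cmod (h y - x0)%C))
    _ 0 _ _ (fun y Hy => proj1 (Eq y Hy)) _ L1).
  apply filterlim_lin2; [exact _|exact LRe|].
  apply filterlim_ln_Cmod; [exact _|exact N1|exact Lx].
- replace (x0 * PI) with (1 * 0 + x0 * PI) by ring.
  rewrite <- (Rmult_1_l (Im (gamma t))).
  refine (filterlim_at_right_eq
    (fun y => 1 * Im (h y) + x0 * Carg (h y - x0)%C)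
    _ 0 _ _ (fun y Hy => proj2 (Eq y Hy)) _ L2).
  apply filterlim_lin2; [exact _|exact LIm|].
  apply filterlim_Carg; [exact _|exact N1| | |exact Lx].
  + rewrite Im_minus_RtoC; exact HIm.
  + apply at_right_forall; intros y Hy; rewrite Im_minus_RtoC; apply Rlt_le, Hh, Hy.
Qed.

(* With r = |z|, the two bounds give x0 / r <= 2 M + |ln r|, while
   r |ln r| <= 2 sqrt r. *)
Lemma log_minus_inverse_unbounded (a M : R) :
  0 < a -> 0 <= M -> exists d, 0 < d /\ forall z : C, 0 < Cmod z < d ->
    Rabs (ln (Cmod z) - a * (Re z / Cmod z ^ 2)) <= M ->
    Rabs (a * (Im z / Cmod z ^ 2)) <= M -> False.
Proof.
intros Ha HM.
(* For s = sqrt r < s0 <= 1 the assumed bounds will give a <= 2 M r + 2 s <= (2 M + 2) s, whereas s0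
   is small enough for (2 M + 3) s < a. *)
assert (Hq0 : 0 < a / (2 * M + 3)) by (apply Rdiv_lt_0_compat; lra).
set (s0 := Rmin 1 (a / (2 * M + 3))).
assert (Hs0 : 0 < s0) by (apply Rmin_pos; lra).
assert (Hs1 : s0 <= 1) by apply Rmin_l.
assert (Hs2 : s0 <= a / (2 * M + 3)) by apply Rmin_r.
exists (s0 ^ 2). split; [nra|].
intros z Hz H1 H2.
set (r := Cmod z) in *.
assert (Hr := Cmod2_alt z). fold r in Hr.
set (s := sqrt r).
assert (Hs : 0 < s) by (apply sqrt_lt_R0; lra).
assert (Hsr : s * s = r) by (apply sqrt_sqrt; lra).
assert (Hss : s < s0) by nra.
assert (Hln : - ln r <= 2 / s).
{ rewrite <- Hsr, ln_mult by lra.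
  assert (H := exp_ineq1_le (- ln s)). rewrite exp_Ropp, exp_ln in H by lra.
  unfold Rdiv. lra. }
assert (Hln0 : ln r < 0) by (rewrite <- ln_1; apply ln_increasing; nra).
set (A := a * (Re z / r ^ 2)) in *. set (B := a * (Im z / r ^ 2)) in *.
assert (HAB : A ^ 2 + B ^ 2 = (a / r) ^ 2).
{ unfold A, B. replace ((a * (Re z / r ^ 2)) ^ 2 + (a * (Im z / r ^ 2)) ^ 2)
    with (a ^ 2 * (Re z ^ 2 + Im z ^ 2) / r ^ 4) by (field; lra).
  rewrite <- Hr. field; lra. }
apply Rabs_le_between in H1. apply Rabs_le_between in H2.
assert (Har : 0 < a / r) by (apply Rdiv_lt_0_compat; lra).
(* A and B are, up to sign, the parts of a / z, so a / r <= |A| + |B|, where |A| <= M + |ln r| and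
   |B| <= M. *)
assert (Hb : a / r <= 2 * M + 2 / s).
{ apply Rnot_lt_le. intros H.
  assert (HA : Rabs A <= M + 2 / s) by (apply Rabs_le_between; lra).
  assert (HB : Rabs B <= M) by (apply Rabs_le_between; lra).
  assert (PA := Rabs_pos A). assert (PB := Rabs_pos B).
  rewrite <- (pow2_abs A), <- (pow2_abs B) in HAB.
  assert (Rabs A + Rabs B < a / r) by lra. nra. }
assert (Hc : a <= 2 * M * r + 2 * s).
{ apply Rmult_le_compat_r with (r := r) in Hb; [|lra].
  replace (a / r * r) with a in Hb by (field; lra).
  replace ((2 * M + 2 / s) * r) with (2 * M * r + 2 * s) in Hb
    by (rewrite <- Hsr; field; lra).
  exact Hb. }
assert (s * (2 * M + 3) < a).
{ apply Rlt_le_trans with (s0 * (2 * M + 3)); [nra|].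
  apply Rle_div_r in Hs2; lra. }
assert (2 * M * r <= 2 * M * s) by (apply Rmult_le_compat_l; nra).
lra.
Qed.

(** At the tip u - x = -D, so D / (u - x) is -1: this is the origin of the constant 1, and the
    correction to the argument vanishes. *)
Lemma sle0_rho_m4_curve_equations (x0 : R) (W x : R -> R) (tau : Rbar) (gamma : R -> C) (t : R) :
  0 < x0 -> chordal_SLE0 (-4) x0 W x tau gamma -> upto tau t ->
  0 <= Im (gamma t) /\ (gamma t - x0)%C <> 0%C /\
  ln (Cmod (gamma t - x0)%C) -
    x0 * (Re (gamma t - x0)%C / Cmod (gamma t - x0)%C ^ 2) = ln (x t - W t) + 1 /\
  Carg (gamma t - x0)%C +
    x0 * (Im (gamma t - x0)%C / Cmod (gamma t - x0)%C ^ 2) = PI.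
Proof.
intros Hx0 Hs Ht.
destruct (sle0_tip_sequence _ _ _ _ _ _ t Hs Ht) as [h [Lh Hh]].
assert (HD := sle0_gap_pos _ _ _ _ _ _ Hx0 Hs t Ht).
assert (FR := at_right_proper_filter 0).
assert (HIm : 0 <= Im (gamma t)).
{ apply (filterlim_Im_ge0 h); [intros y Hy; apply Hh, Hy|exact Lh]. }
assert (Eq : forall y, 0 < y ->
  1 * ln (Cmod (h y - x0)%C) + - x0 * (Re (h y - x0)%C / Cmod (h y - x0)%C ^ 2) =
  1 * ln (Cmod (W t + Ci * y - x t)%C) + - (x t - W t) *
    (Re (W t + Ci * y - x t)%C / Cmod (W t + Ci * y - x t)%C ^ 2) /\
  1 * Carg (h y - x0)%C + x0 * (Im (h y - x0)%C / Cmod (h y - x0)%C ^ 2) =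
  1 * Carg (W t + Ci * y - x t)%C + (x t - W t) *
    (Im (W t + Ci * y - x t)%C / Cmod (W t + Ci * y - x t)%C ^ 2)).
{ intros y Hy. destruct (Hh y Hy) as [Hhy [S [u [HS [HtS [Hu Eu]]]]]].
  destruct (sle0_conserved_rho_m4 x0 W x tau gamma S (h y) u t Hs HS Hu Hhy HtS)
    as [H1 H2].
  - rewrite Eu. simpl. lra.
  - rewrite Eu in H1, H2. split; lra. }
destruct (filterlim_log_tip (W t) (x t)) as [T1 T2]; [lra|].
assert (Es1 : arg_of_sign (W t - x t) = PI).
{ unfold arg_of_sign. destruct (Rlt_dec 0 (W t - x t)); [lra|reflexivity]. }
rewrite Es1 in T2. rewrite Rabs_minus_sym, Rabs_pos_eq in T1 by lra.
assert (Htip : RtoC (W t - x t) <> 0%C) by (intros E; injection E; lra).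
destruct (filterlim_div_Cmod_sqr (at_right 0) _ _ Htip (filterlim_tip (W t) (x t))) as [T3 T4].
rewrite Cmod_R, pow2_abs in T3, T4. change (Re (W t - x t)%R) with (W t - x t) in T3.
change (Im (W t - x t)%R) with 0 in T4.
assert (L1 := filterlim_lin2 (at_right 0) _ _ 1 (- (x t - W t)) _ _ T1 T3).
assert (L2 := filterlim_lin2 (at_right 0) _ _ 1 (x t - W t) _ _ T2 T4).
replace (1 * ln (x t - W t) + - (x t - W t) * ((W t - x t) / (W t - x t) ^ 2))
  with (ln (x t - W t) + 1) in L1 by (field; lra).
replace (1 * PI + (x t - W t) * (0 / (W t - x t) ^ 2)) with PI in L2 by (field; lra).
assert (Lx := filterlim_Cminus_const (at_right 0) h (gamma t) x0 Lh).
assert (Hneq : forall y, 0 < y -> (h y - x0)%C <> 0%C).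
{ intros y Hy. apply upper_neq_real, Hh, Hy. }
(* Otherwise z = h y - x0 would tend to 0 while both parts of log z - x0 / z converge. The argument
   is between 0 and PI, so the parts of x0 / z would be controlled as in
   [log_minus_inverse_unbounded], which is impossible near 0. *)
assert (N1 : (gamma t - x0)%C <> 0%C).
{ intros E. rewrite E in Lx.
  assert (HP := PI_RGT_0).
  set (m := ln (x t - W t) + 1) in *.
  assert (Hm := Rabs_pos m).
  destruct (log_minus_inverse_unbounded x0 (Rabs m + 2 * PI + 1) Hx0) as [d [Hd0 Hd]]; [lra|].
  assert (Q1 := proj1 (filterlim_R_iff (at_right 0) _ _) L1 1 Rlt_0_1).
  assert (Q2 := proj1 (filterlim_R_iff (at_right 0) _ _) L2 1 Rlt_0_1).
  assert (Q3 := proj1 (filterlim_C_iff (at_right 0) _ _) Lx d Hd0).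
  assert (Q0 : at_right 0 (fun y => 0 < y)) by (apply at_right_forall; auto).
  destruct (filter_ex _ (filter_and _ _ Q0 (filter_and _ _ Q1 (filter_and _ _ Q2 Q3))))
    as [y [Hy [K1 [K2 K3]]]].
  cbv beta in K1, K2. destruct (Eq y Hy) as [E1 E2]. rewrite <- E1 in K1. rewrite <- E2 in K2.
  replace (h y - x0 - 0)%C with (h y - x0)%C in K3 by ring.
  apply (Hd (h y - x0)%C).
  - split; [apply Cmod_gt_0, Hneq, Hy|exact K3].
  - assert (Hm1 := Rle_abs m). assert (Hm2 := Rle_abs (- m)). rewrite Rabs_Ropp in Hm2.
    apply Rabs_def2 in K1. apply Rabs_le_between. lra.
  - rewrite Carg_upper in K2 by (rewrite Im_minus_RtoC; apply Rlt_le, Hh, Hy).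
    assert (HA := acos_bound (Re (h y - x0)%C / Cmod (h y - x0)%C)).
    apply Rabs_def2 in K2. apply Rabs_le_between. lra. }
destruct (filterlim_div_Cmod_sqr (at_right 0) _ _ N1 Lx) as [M1 M2].
split; [exact HIm|]. split; [exact N1|]. split.
- replace (ln (Cmod (gamma t - x0)%C) -
    x0 * (Re (gamma t - x0)%C / Cmod (gamma t - x0)%C ^ 2)) with
   (1 * ln (Cmod (gamma t - x0)%C) +
    - x0 * (Re (gamma t - x0)%C / Cmod (gamma t - x0)%C ^ 2)) by ring.
  refine (filterlim_at_right_eq
    (fun y => 1 * ln (Cmod (h y - x0)%C) +
      - x0 * (Re (h y - x0)%C / Cmod (h y - x0)%C ^ 2))
    _ 0 _ _ (fun y Hy => proj1 (Eq y Hy)) _ L1).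
  apply filterlim_lin2; [exact _| |exact M1].
  apply filterlim_ln_Cmod; [exact _|exact N1|exact Lx].
- rewrite <- (Rmult_1_l (Carg (gamma t - x0)%C)).
  refine (filterlim_at_right_eq
    (fun y => 1 * Carg (h y - x0)%C +
      x0 * (Im (h y - x0)%C / Cmod (h y - x0)%C ^ 2))
    _ 0 _ _ (fun y Hy => proj2 (Eq y Hy)) _ L2).
  apply filterlim_lin2; [exact _| |exact M2].
  apply filterlim_Carg; [exact _|exact N1| | |exact Lx].
  + rewrite Im_minus_RtoC; exact HIm.
  + apply at_right_forall; intros y Hy; rewrite Im_minus_RtoC; apply Rlt_le, Hh, Hy.
Qed.

Lemma before_filter (T : Rbar) : Filter (before T).
Proof.
change (Filter (within (fun t : R => Rbar_lt t T) (Rbar_locally T))).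
apply within_filter, Rbar_locally_filter.
Qed.

(** * Hitting points and angles *)

(* If A and B separated the path, the function equal to -1 on A and 1 on B
   would be continuous along it. *)
Lemma connected_path (path : R -> C) :
  (forall s, filterlim path (locally s) (locally (path s))) ->
  connected_set (fun z => exists s, z = path s).
Proof.
intros Hc A B OA OB Hcov [za [[a ->] Ha]] [zb [[b ->] Hb]].
apply NNPP; intros Hno.
assert (Hdis : forall s, A (path s) -> B (path s) -> False).
{ intros s H1 H2. apply Hno. exists (path s). split; [exists s; reflexivity|tauto]. }
set (f := fun s => if excluded_middle_informative (A (path s)) then -1 else 1).
assert (fA : forall s, A (path s) -> f s = -1).
{ intros s H. unfold f. destruct (excluded_middle_informative (A (path s))); tauto. }
assert (fB : forall s, B (path s) -> f s = 1).
{ intros s H. unfold f. destruct (excluded_middle_informative (A (path s))); [|reflexivity].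
  elim (Hdis s); assumption. }
assert (Hf : continuity f).
{ intros s. apply continuity_pt_filterlim.
  assert (Hconst : forall (O : C -> Prop) l, open O -> O (path s) ->
    (forall r, O (path r) -> f r = l) -> filterlim f (locally s) (locally (f s))).
  { intros O l HO HOs Hl. rewrite (Hl s HOs).
    apply filterlim_ext_loc with (fun _ => l); [|apply filterlim_const].
    generalize (Hc s _ (HO _ HOs)). unfold filtermap. apply filter_imp.
    intros r Hr. symmetry. apply Hl, Hr. }
  destruct (Hcov (path s)) as [H|H]; [exists s; reflexivity| |].
  - exact (Hconst A (-1) OA H fA).
  - exact (Hconst B 1 OB H fB). }
destruct (IVT_gen f a b 0 Hf) as [s [_ Hs]].
- rewrite (fA a Ha), (fB b Hb). rewrite Rmin_left, Rmax_right; lra.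
- unfold f in Hs. destruct (excluded_middle_informative (A (path s))); lra.
Qed.

Lemma Cmod_scale (l : R) (z : C) : 0 <= l -> Cmod (l * z)%C = l * Cmod z.
Proof. intros H. rewrite Cmod_mult, Cmod_R, Rabs_pos_eq by exact H. reflexivity. Qed.

Lemma Re_scale (l : R) (z : C) : Re (l * z)%C = l * Re z.
Proof. simpl. unfold Re. ring. Qed.

Lemma Im_scale (l : R) (z : C) : Im (l * z)%C = l * Im z.
Proof. simpl. unfold Im. ring. Qed.

Lemma Carg_scale (l : R) (z : C) : 0 < l -> z <> 0%C -> 0 <= Im z -> Carg (l * z)%C = Carg z.
Proof.
intros Hl Hz HI. rewrite !Carg_upper; [|exact HI|rewrite Im_scale; nra].
rewrite Cmod_scale, Re_scale by lra. f_equal. field.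
split; [|lra]. apply Rgt_not_eq, Cmod_gt_0, Hz.
Qed.

Lemma unbounded_component_ray (E : C -> Prop) (P : R) (z : C) :
  (z - P)%C <> 0%C -> (forall l : R, 1 <= l -> E (P + l * (z - P))%C) ->
  in_unbounded_component E z.
Proof.
intros Hz HE M.
assert (Hm : 0 < Cmod (z - P)%C) by (apply Cmod_gt_0, Hz).
(* As 1 + s^2 maps R onto [1, oo), the half-ray beyond z is the image of a path defined on all of R,
   the form that [connected_path] handles. *)
set (path := fun s : R => (P + RtoC (1 + s ^ 2) * (z - P))%C).
(* Chosen so that s0 |z - P| = |z - P| + |M| + |P|; with 1 + s0^2 >= s0, the point of parameter s0
   has modulus larger than M. *)
set (s0 := 1 + (Rabs M + Rabs P) / Cmod (z - P)%C).
assert (HM := Rabs_pos M). assert (HP := Rabs_pos P). assert (HM1 := Rle_abs M).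
assert (Hs0 : 1 <= s0).
{ unfold s0. assert (0 <= (Rabs M + Rabs P) / Cmod (z - P)%C); [|lra].
  apply Rdiv_le_0_compat; lra. }
exists (path s0). split.
- exists (fun w => exists s, w = path s). repeat split.
  + apply connected_path. intros s.
    apply filterlim_ext with (fun r => (P + (1 + r ^ 2) * (Re z - P), (1 + r ^ 2) * Im z) : C).
    { intros r. unfold path. rewrite Cminus_RtoC.
      apply injective_projections; simpl; ring. }
    unfold path. rewrite Cminus_RtoC.
    replace (P + RtoC (1 + s ^ 2) * ((Re z - P)%R, Im z))%C with
      ((P + (1 + s ^ 2) * (Re z - P), (1 + s ^ 2) * Im z) : C)
      by (apply injective_projections; simpl; ring).
    apply filterlim_C_pair; [exact _| |].
    * apply (ex_derive_continuous (fun r => P + (1 + r ^ 2) * (Re z - P))).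
      auto_derive. exact I.
    * apply (ex_derive_continuous (fun r => (1 + r ^ 2) * Im z)). auto_derive. exact I.
  + intros w [s ->]. apply HE. assert (H := pow2_ge_0 s). lra.
  + exists 0. unfold path. apply injective_projections; simpl; ring.
  + exists s0. reflexivity.
- unfold path.
  assert (H := Cmod_triangle (P + RtoC (1 + s0 ^ 2) * (z - P))%C (- P)%C).
  replace (P + RtoC (1 + s0 ^ 2) * (z - P) + - P)%C with (RtoC (1 + s0 ^ 2) * (z - P))%C in H
    by ring.
  rewrite Cmod_opp, Cmod_R, Cmod_scale in H by nra.
  assert (E1 : s0 * Cmod (z - P)%C = Cmod (z - P)%C + (Rabs M + Rabs P))
    by (unfold s0; field; lra).
  assert (s0 * Cmod (z - P)%C <= (1 + s0 ^ 2) * Cmod (z - P)%C)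
    by (apply Rmult_le_compat_r; nra).
  lra.
Qed.

Lemma curve_complement_ray (gamma : R -> C) (tau : Rbar) (P : R) (z : C) :
  halfplane z ->
  (forall l t, 1 <= l -> upto tau t -> (gamma t - P)%C <> (l * (z - P))%C) ->
  in_unbounded_component (curve_complement gamma tau) z.
Proof.
intros Hz H. apply unbounded_component_ray with P; [apply upper_neq_real, Hz|].
intros l Hl. split.
- unfold halfplane in *. rewrite Cminus_RtoC. simpl. nra.
- intros t Ht E. apply (H l t Hl Ht). rewrite <- E. ring.
Qed.

(** The ray from P through z has a constant argument, smaller than every argument the curve takes
    around P, so it escapes to infinity without meeting the curve. *)
Lemma curve_complement_sector (gamma : R -> C) (tau : Rbar) (P theta : R) (z : C) :
  (forall t, upto tau t -> theta <= Carg (gamma t - P)%C) ->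
  halfplane z -> Carg (z - P)%C < theta ->
  in_unbounded_component (curve_complement gamma tau) z.
Proof.
intros H Hz Hth. apply curve_complement_ray with P; [exact Hz|].
intros l t Hl Ht E. specialize (H t Ht). rewrite E, Carg_scale in H; try lra.
- apply upper_neq_real, Hz.
- rewrite Im_minus_RtoC. apply Rlt_le, Hz.
Qed.

Lemma Carg_bound (z : C) : 0 <= Im z -> 0 <= Carg z <= PI.
Proof. intros H. rewrite Carg_upper by exact H. apply acos_bound. Qed.

Lemma Carg_polar (r phi : R) : 0 < r -> 0 <= phi <= PI -> Carg (r * (cos phi, sin phi))%C = phi.
Proof.
intros Hr Hphi.
assert (HS : 0 <= sin phi) by (apply sin_ge_0; lra).
assert (E : Cmod (cos phi, sin phi) = 1).
{ unfold Cmod. simpl fst. simpl snd. rewrite <- !Rsqr_pow2, Rplus_comm, sin2_cos2. apply sqrt_1. }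
rewrite Carg_scale; [|exact Hr| |exact HS].
- rewrite Carg_upper by exact HS. rewrite E. simpl Re. unfold Rdiv.
  rewrite Rinv_1, Rmult_1_r. apply acos_cos, Hphi.
- apply Cmod_gt_0. rewrite E. lra.
Qed.

Lemma Carg_vertical (q P eps : R) :
  P < q -> 0 < eps -> at_right 0 (fun y : R => Carg ((q + Ci * y) - P)%C < eps).
Proof.
intros Hq He.
destruct (filterlim_log_tip q P) as [_ L]; [lra|].
unfold arg_of_sign in L. destruct (Rlt_dec 0 (q - P)) as [_|]; [|lra].
generalize (proj1 (filterlim_R_iff (at_right 0) _ _) L eps He).
apply filter_imp. intros y Hy. rewrite Rminus_0_r in Hy. apply Rabs_def2 in Hy. lra.
Qed.

(** P is the singularity with the larger weight a. Away from P the left side of the logarithmic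
    equation is bounded below, even near infinity since a > b, while its right side tends to -oo
    with D. This forces convergence to P. There the argument around Q tends to 0, because Q < P, and
    the linear relation between the arguments gives the limit PI (1 - b / a). *)
Lemma curve_hits (gamma : R -> C) (tau : Rbar) (D : R -> R) (P Q a b c : R) :
  Q < P -> 0 < b < a ->
  (forall eps, 0 < eps -> before tau (fun t => upto tau t /\ 0 < D t < eps)) ->
  (forall t, upto tau t -> 0 <= Im (gamma t) /\
    (gamma t - P)%C <> 0%C /\ (gamma t - Q)%C <> 0%C /\
    a * ln (Cmod (gamma t - P)%C) - b * ln (Cmod (gamma t - Q)%C) = (a - b) * ln (D t) + c /\
    a * (PI - Carg (gamma t - P)%C) = b * (PI - Carg (gamma t - Q)%C)) ->
  filterlim gamma (before tau) (locally (RtoC P)) /\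
  outer_hitting_angle gamma tau P (PI * (1 - b / a)).
Proof.
intros HQP Hab HD Hg.
assert (FB := before_filter tau).
assert (HPI := PI_RGT_0).
assert (Hba : 0 < b / a < 1).
{ split; [apply Rdiv_lt_0_compat; lra|apply Rlt_div_l; lra]. }
assert (Lim : filterlim gamma (before tau) (locally (RtoC P))).
{ apply filterlim_C_iff; [exact FB|]. intros eps He.
  set (d := P - Q). assert (Hd : 0 < d) by (unfold d; lra).
  assert (Hde : 0 < d / eps) by (apply Rdiv_lt_0_compat; lra).
  (* A lower bound of a ln r - b ln r' for r >= eps, from r' <= r + d <= r (1 + d / eps). The
     exponential below is the value of D at which the right side equals m. *)
  set (m := (a - b) * ln eps - b * ln (1 + d / eps)).
  generalize (HD (exp ((m - c) / (a - b))) (exp_pos _)). apply filter_imp.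
  intros t [Ht [HD0 HD1]].
  destruct (Hg t Ht) as [_ [N1 [N2 [E _]]]].
  apply Cmod_gt_0 in N1. apply Cmod_gt_0 in N2.
  apply Rnot_le_lt. intros Hr.
  assert (Htri := Cmod_triangle (gamma t - P)%C (RtoC d)).
  replace (gamma t - P + RtoC d)%C with (gamma t - Q)%C in Htri
    by (unfold d; rewrite RtoC_minus; ring).
  rewrite Cmod_R, Rabs_pos_eq in Htri by lra.
  set (r := Cmod (gamma t - P)%C) in *. set (r' := Cmod (gamma t - Q)%C) in *.
  assert (H1 : ln r' <= ln r + ln (1 + d / eps)).
  { rewrite <- ln_mult by lra. apply ln_le; [lra|].
    apply Rle_trans with (1 := Htri).
    assert (d <= r * (d / eps)); [|lra].
    apply Rle_trans with (eps * (d / eps)); [right; field; lra|].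
    apply Rmult_le_compat_r; lra. }
  assert (H2 : ln eps <= ln r) by (apply ln_le; lra).
  assert (H3 : ln (D t) < (m - c) / (a - b)).
  { rewrite <- (ln_exp ((m - c) / (a - b))). apply ln_increasing; assumption. }
  apply Rlt_div_r in H3; [|lra].
  assert (H4 : (a - b) * ln eps <= (a - b) * ln r) by (apply Rmult_le_compat_l; lra).
  assert (H5 : b * ln r' <= b * (ln r + ln (1 + d / eps))) by (apply Rmult_le_compat_l; lra).
  unfold m in H3. lra. }
assert (HA : forall t, upto tau t ->
  Carg (gamma t - P)%C = PI - b / a * (PI - Carg (gamma t - Q)%C)).
{ intros t Ht. destruct (Hg t Ht) as [_ [_ [_ [_ E]]]].
  apply Rmult_eq_reg_l with a; [|lra].
  transitivity (a * PI - b * (PI - Carg (gamma t - Q)%C)); [lra|field; lra]. }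
(* The limiting angle is also a lower bound at all times, since the argument around Q is
   nonnegative; this keeps the whole sector free of the curve. *)
assert (Hsec : forall t, upto tau t -> PI * (1 - b / a) <= Carg (gamma t - P)%C).
{ intros t Ht. rewrite (HA t Ht).
  destruct (Hg t Ht) as [HI _].
  destruct (Carg_bound (gamma t - Q)%C) as [H1 H2]; [rewrite Im_minus_RtoC; exact HI|].
  nra. }
assert (Hup : before tau (upto tau)).
{ generalize (HD 1 Rlt_0_1). apply filter_imp. tauto. }
split; [exact Lim|].
split; [split; nra|]. split; [exact Lim|]. split; [|split].
- apply filterlim_ext_loc with (fun t => 1 * (PI - b / a * PI) + b / a * Carg (gamma t - Q)%C).
  { revert Hup. apply filter_imp. intros t Ht. rewrite (HA t Ht). ring. }
  replace (PI * (1 - b / a)) with (1 * (PI - b / a * PI) + b / a * 0) by ring.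
  apply filterlim_lin2; [exact FB|apply filterlim_const|].
  replace 0 with (Carg (RtoC (P - Q))).
  + rewrite RtoC_minus. apply filterlim_Carg; [exact FB| | | |].
    * rewrite <- RtoC_minus. intros E. injection E. lra.
    * simpl. lra.
    * revert Hup. apply filter_imp. intros t Ht. rewrite Im_minus_RtoC. apply Hg, Ht.
    * apply filterlim_Cminus_const; assumption.
  + rewrite Carg_real by lra. unfold arg_of_sign.
    destruct (Rlt_dec 0 (P - Q)); [reflexivity|lra].
- intros phi Hphi. apply at_right_forall. intros r Hr.
  apply (curve_complement_sector gamma tau P (PI * (1 - b / a)) _ Hsec).
  + unfold halfplane. simpl. assert (0 < sin phi) by (apply sin_gt_0; nra). nra.
  + replace (P + r * (cos phi, sin phi) - P)%C with (r * (cos phi, sin phi))%C by ring.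
    rewrite Carg_polar; nra.
- intros q Hq. generalize (Carg_vertical q P (PI * (1 - b / a)) Hq ltac:(nra)).
  intros H. generalize (filter_and _ _ H (at_right_forall 0 (fun y => 0 < y) (fun y Hy => Hy))).
  apply filter_imp. intros y [H1 H2].
  apply (curve_complement_sector gamma tau P (PI * (1 - b / a)) _ Hsec).
  + unfold halfplane. simpl. lra.
  + exact H1.
Qed.

Lemma sle0_gap_vanishes (rho x0 : R) (W x : R -> R) (tau : Rbar) (gamma : R -> C) :
  0 < x0 -> chordal_SLE0 rho x0 W x tau gamma -> rho < -2 ->
  forall eps, 0 < eps ->
  before tau (fun t => upto tau t /\ 0 < x t - W t < eps).
Proof.
intros Hx0 Hs Hr eps He.
assert (Etau := sle0_lifetime_finite _ _ _ _ _ _ Hx0 Hs Hr).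
set (T := - (x0 ^ 2 / (2 * (2 + rho)))) in Etau.
assert (HT : x0 ^ 2 + 2 * (2 + rho) * T = 0) by (unfold T; field; lra).
assert (HT0 : 0 < T) by nra.
assert (He2 : 0 < eps ^ 2 / (2 * - (2 + rho))) by (apply Rdiv_lt_0_compat; nra).
(* The bound T keeps t positive; the other one suffices because D^2 = -2 (2 + rho) (T - t). *)
set (d := Rmin T (eps ^ 2 / (2 * - (2 + rho)))).
assert (Hd0 : 0 < d) by (apply Rmin_pos; assumption).
assert (Hd1 : d <= T) by apply Rmin_l.
assert (Hd2 : d <= eps ^ 2 / (2 * - (2 + rho))) by apply Rmin_r.
apply Rle_div_r in Hd2; [|lra].
enough (H : forall t, T - d < t < T -> upto tau t /\ 0 < x t - W t < eps).
{ rewrite Etau at 1. exists (mkposreal d Hd0). refine (fun (t : R) Ht HtT => H t _).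
  change (Rabs (t - T) < d) in Ht. apply Rabs_def2 in Ht. change (t < T) in HtT. lra. }
intros t Ht.
assert (Hu : upto tau t) by (rewrite Etau; split; [lra|exact (proj2 Ht)]).
assert (H1 := sle0_gap_sqr _ _ _ _ _ _ Hs t Hu).
assert (H2 := sle0_gap_pos _ _ _ _ _ _ Hx0 Hs t Hu).
split; [exact Hu|]. split; [exact H2|].
apply Rnot_le_lt. intros H3. nra.
Qed.

(** Here -(2 + rho) > 2, so x0 carries the larger weight, and p lies to its left. *)
Lemma sle0_hits_force_point (rho x0 : R) (W x : R -> R) (tau : Rbar) (gamma : R -> C) :
  0 < x0 -> chordal_SLE0 rho x0 W x tau gamma -> rho < -4 ->
  filterlim gamma (before tau) (locally (RtoC x0)) /\
  outer_hitting_angle gamma tau x0 (PI * ((4 + rho) / (2 + rho))).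
Proof.
intros Hx0 Hs Hr.
replace ((4 + rho) / (2 + rho)) with (1 - 2 / - (2 + rho)) by (field; lra).
set (p := - 2 / (2 + rho) * x0).
assert (Hk : 0 < / - (2 + rho) < / 2).
{ split; [apply Rinv_0_lt_compat; lra|apply Rinv_lt_contravar; lra]. }
assert (Ep : p = 2 * / - (2 + rho) * x0) by (unfold p; field; lra).
apply (curve_hits gamma tau (fun t => x t - W t) x0 p (- (2 + rho)) 2
  (- 2 * ln (Rabs (2 / (2 + rho))))); [nra|lra| |].
- intros eps He. apply (sle0_gap_vanishes _ _ _ _ _ _ Hx0 Hs); lra.
- intros t Ht.
  destruct (sle0_curve_equations rho x0 W x tau gamma t Hx0) as [H1 [H2 [H3 [H4 H5]]]];
    try assumption; try lra.
  fold p in H3, H4, H5.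
  assert (HD := sle0_gap_pos _ _ _ _ _ _ Hx0 Hs t Ht).
  assert (Hneg : 2 / (2 + rho) < 0).
  { replace (2 / (2 + rho)) with (- (2 * / - (2 + rho))) by (field; lra). lra. }
  assert (Habs : 0 < Rabs (2 / (2 + rho))) by (rewrite Rabs_left; lra).
  rewrite ln_mult in H4 by assumption.
  assert (Es : arg_of_sign (2 / (2 + rho)) = PI).
  { unfold arg_of_sign. destruct (Rlt_dec 0 (2 / (2 + rho))); [lra|reflexivity]. }
  rewrite Es in H5.
  repeat split; try assumption; lra.
Qed.

(** Now 2 > -(2 + rho) > 0: the dual point carries the larger weight and has moved to the right of
    x0. *)
Lemma sle0_hits_dual_point (rho x0 : R) (W x : R -> R) (tau : Rbar) (gamma : R -> C) :
  0 < x0 -> chordal_SLE0 rho x0 W x tau gamma -> -4 < rho < -2 ->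
  x0 < - (2 / (rho + 2)) * x0 /\
  filterlim gamma (before tau) (locally (RtoC (- (2 / (rho + 2)) * x0))) /\
  outer_hitting_angle gamma tau (- (2 / (rho + 2)) * x0) (PI * ((4 + rho) / 2)).
Proof.
intros Hx0 Hs Hr.
replace ((4 + rho) / 2) with (1 - - (2 + rho) / 2) by field.
replace (- (2 / (rho + 2)) * x0) with (- 2 / (2 + rho) * x0) by (field; lra).
set (p := - 2 / (2 + rho) * x0).
assert (Hk : / 2 < / - (2 + rho)) by (apply Rinv_lt_contravar; lra).
assert (Ep : p = 2 * / - (2 + rho) * x0) by (unfold p; field; lra).
assert (Hp : x0 < p) by nra.
split; [exact Hp|].
apply (curve_hits gamma tau (fun t => x t - W t) p x0 2 (- (2 + rho))
  (2 * ln (Rabs (2 / (2 + rho))))); [exact Hp|lra| |].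
- intros eps He. apply (sle0_gap_vanishes _ _ _ _ _ _ Hx0 Hs); lra.
- intros t Ht.
  destruct (sle0_curve_equations rho x0 W x tau gamma t Hx0) as [H1 [H2 [H3 [H4 H5]]]];
    try assumption; try lra.
  fold p in H3, H4, H5.
  assert (HD := sle0_gap_pos _ _ _ _ _ _ Hx0 Hs t Ht).
  assert (Hneg : 2 / (2 + rho) < 0).
  { replace (2 / (2 + rho)) with (- (2 * / - (2 + rho))) by (field; lra). lra. }
  assert (Habs : 0 < Rabs (2 / (2 + rho))) by (rewrite Rabs_left; lra).
  rewrite ln_mult in H4 by assumption.
  assert (Es : arg_of_sign (2 / (2 + rho)) = PI).
  { unfold arg_of_sign. destruct (Rlt_dec 0 (2 / (2 + rho))); [lra|reflexivity]. }
  rewrite Es in H5.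
  repeat split; try assumption; lra.
Qed.

(** Write sin d = 2 sin(d/2) cos(d/2) and sin(d/2) = (d/2) cos c with c < d/2; both cosines are at
    least cos(PI/2 - e/2) = sin(e/2). It serves with d = PI - A for an argument A >= e. *)
Lemma sin_linear_lower (e d : R) :
  0 < e <= PI -> 0 < d <= PI - e -> d * sin (e / 2) ^ 2 <= sin d.
Proof.
intros He Hd.
assert (Hs : 0 < sin (e / 2)) by (apply sin_gt_0; lra).
assert (Hc : sin (e / 2) <= cos (d / 2)).
{ rewrite <- cos_shift. apply cos_decr_1; lra. }
destruct (MVT_cor2 sin cos 0 (d / 2)) as [c [E Hcd]]; [lra| |].
{ intros c _. apply derivable_pt_lim_sin. }
rewrite sin_0, !Rminus_0_r in E.
assert (Hcc : cos (d / 2) <= cos c) by (apply cos_decr_1; lra).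
replace (sin d) with (2 * sin (d / 2) * cos (d / 2))
  by (rewrite <- sin_2a; f_equal; field).
rewrite E.
assert (sin (e / 2) ^ 2 <= cos c * cos (d / 2)); [|nra].
replace (sin (e / 2) ^ 2) with (sin (e / 2) * sin (e / 2)) by ring.
apply Rmult_le_compat; lra.
Qed.

Lemma sin_Carg (z : C) : z <> 0%C -> 0 <= Im z -> sin (Carg z) = Im z / Cmod z.
Proof.
intros Hz HI. rewrite Carg_upper by exact HI. apply Cmod_gt_0 in Hz.
rewrite sin_acos by apply Re_div_Cmod_bound.
rewrite <- (sqrt_pow2 (Im z / Cmod z)) by (apply Rdiv_le_0_compat; lra).
f_equal. assert (H := Cmod2_alt z). unfold Rsqr.
transitivity ((Cmod z ^ 2 - Re z ^ 2) / Cmod z ^ 2); [field; lra|].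
replace (Cmod z ^ 2 - Re z ^ 2) with (Im z ^ 2) by lra. field; lra.
Qed.

Lemma cos_Carg (z : C) : 0 <= Im z -> cos (Carg z) = Re z / Cmod z.
Proof.
intros HI. rewrite Carg_upper by exact HI. apply cos_acos, Re_div_Cmod_bound.
Qed.

Lemma Im_div_sqr_scale (l : R) (z : C) :
  0 < l -> z <> 0%C -> Im (l * z)%C / Cmod (l * z)%C ^ 2 = Im z / Cmod z ^ 2 / l.
Proof.
intros Hl Hz. apply Cmod_gt_0 in Hz. rewrite Im_scale, Cmod_scale by lra.
field. lra.
Qed.

Lemma sle0_rho_m4_hits (x0 : R) (W x : R -> R) (tau : Rbar) (gamma : R -> C) :
  0 < x0 -> chordal_SLE0 (-4) x0 W x tau gamma ->
  filterlim gamma (before tau) (locally (RtoC x0)) /\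
  outer_hitting_angle gamma tau x0 0.
Proof.
intros Hx0 Hs.
assert (FB := before_filter tau).
assert (HPI := PI_RGT_0).
assert (HD : forall eps, 0 < eps ->
  before tau (fun t => upto tau t /\ 0 < x t - W t < eps)).
{ apply (sle0_gap_vanishes _ _ _ _ _ _ Hx0 Hs). lra. }
assert (HD' : forall m, before tau (fun t => upto tau t /\ ln (x t - W t) < m)).
{ intros m. generalize (HD (exp m) (exp_pos m)). apply filter_imp.
  intros t [Ht [H1 H2]]. split; [exact Ht|].
  rewrite <- (ln_exp m). apply ln_increasing; assumption. }
assert (Hcv : forall eps, 0 < eps -> before tau (fun t => Cmod (gamma t - x0)%C < eps)).
{ intros eps He. generalize (HD' (ln eps - x0 / eps - 1)). apply filter_imp.
  intros t [Ht H].
  destruct (sle0_rho_m4_curve_equations _ _ _ _ _ t Hx0 Hs Ht) as [H1 [H2 [H3 _]]].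
  apply Cmod_gt_0 in H2. assert (HRe := re_le_Cmod (gamma t - x0)%C).
  set (r := Cmod (gamma t - x0)%C) in *. set (X := Re (gamma t - x0)%C) in *.
  apply Rnot_le_lt. intros Hr.
  assert (ln eps <= ln r) by (apply ln_le; lra).
  assert (X <= r) by (apply Rle_trans with (2 := HRe), Rle_abs).
  assert (X / r ^ 2 <= / eps).
  { apply Rle_trans with (/ r); [|apply Rinv_le_contravar; lra].
    apply Rle_div_l; [nra|]. replace (/ r * r ^ 2) with r by (field; lra). lra. }
  assert (x0 * (X / r ^ 2) <= x0 / eps) by (apply Rmult_le_compat_l; lra).
  lra. }
assert (Lim : filterlim gamma (before tau) (locally (RtoC x0)))
  by (apply filterlim_C_iff; [exact FB|exact Hcv]).
split; [exact Lim|]. split; [lra|]. split; [exact Lim|]. split; [|split; [intros; lra|]].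
- apply filterlim_R_iff; [exact FB|]. intros eps He.
  set (e := Rmin eps PI).
  assert (He0 : 0 < e) by (apply Rmin_pos; lra).
  assert (He1 : e <= eps) by apply Rmin_l.
  assert (He2 : e <= PI) by apply Rmin_r.
  assert (Hse : 0 < sin (e / 2)) by (apply sin_gt_0; lra).
  assert (Hrad : 0 < x0 * sin (e / 2) ^ 2) by (apply Rmult_lt_0_compat; nra).
  (* The imaginary part reads (PI - A) r = x0 sin A; for e <= A < PI it forces r >= x0 sin(e/2)^2,
     hence the radius. The bound D < x0 is for the case A = PI. *)
  generalize (filter_and _ _ (Hcv _ Hrad) (HD' (ln x0))). apply filter_imp.
  intros t [Hr [Ht HDt]].
  destruct (sle0_rho_m4_curve_equations _ _ _ _ _ t Hx0 Hs Ht) as [H1 [H2 [H3 H4]]].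
  assert (HI : 0 <= Im (gamma t - x0)%C) by (rewrite Im_minus_RtoC; exact H1).
  assert (HS := sin_Carg _ H2 HI). assert (HC := cos_Carg _ HI).
  assert (HA := Carg_bound _ HI).
  apply Cmod_gt_0 in H2.
  set (r := Cmod (gamma t - x0)%C) in *. set (A := Carg (gamma t - x0)%C) in *.
  rewrite Rminus_0_r, Rabs_pos_eq by lra. apply Rlt_le_trans with (2 := He1).
  replace (x0 * (Im (gamma t - x0)%C / r ^ 2)) with (x0 * sin A / r) in H4
    by (rewrite HS; field; lra).
  replace (x0 * (Re (gamma t - x0)%C / r ^ 2)) with (x0 * cos A / r) in H3
    by (rewrite HC; field; lra).
  apply Rnot_le_lt. intros HAe.
  (* A = PI solves the imaginary equation, so the real one must exclude it: it becomes ln r + x0 / r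
     = ln D + 1, whose left side is at least ln x0 + 1. *)
  destruct (Req_dec A PI) as [EA|NA].
  + rewrite EA, cos_PI in H3.
    assert (Hln := exp_ineq1_le (ln (x0 / r))).
    assert (Hxr : 0 < x0 / r) by (apply Rdiv_lt_0_compat; lra).
    rewrite exp_ln in Hln by exact Hxr.
    rewrite ln_div in Hln by lra.
    replace (x0 * -1 / r) with (- (x0 / r)) in H3 by (field; lra). lra.
  + assert (Hlow := sin_linear_lower e (PI - A)).
    rewrite sin_PI_x in Hlow.
    specialize (Hlow ltac:(lra) ltac:(lra)).
    assert (Er : (PI - A) * r = x0 * sin A).
    { replace (PI - A) with (x0 * sin A / r) by lra. field; lra. }
    assert ((PI - A) * r < (PI - A) * (x0 * sin (e / 2) ^ 2))
      by (apply Rmult_lt_compat_l; lra).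
    assert (x0 * ((PI - A) * sin (e / 2) ^ 2) <= x0 * sin A)
      by (apply Rmult_le_compat_l; lra).
    lra.
- intros q Hq.
  assert (Hden : 0 < (q - x0) ^ 2) by (apply pow2_gt_0; lra).
  (* The angle is 0, so no sector is available and the ray from x0 through q + i y is tested
     directly. Its argument is below PI/2, and beyond that point x0 Im z / |z|^2 is at most x0 y /
     (q - x0)^2 < PI/2; their sum is less than PI, the value on the curve. *)
  assert (Hqx : 0 < PI / 2 * (q - x0) ^ 2 / x0).
  { apply Rdiv_lt_0_compat; [apply Rmult_lt_0_compat; lra|lra]. }
  assert (Hy : at_right 0 (fun y => 0 < y /\ y < PI / 2 * (q - x0) ^ 2 / x0)).
  { exists (mkposreal _ Hqx). refine (fun (y : R) Hb Hy => conj Hy _).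
    change (Rabs (y - 0) < PI / 2 * (q - x0) ^ 2 / x0) in Hb. apply Rabs_def2 in Hb. lra. }
  assert (HP2 : 0 < PI / 2) by lra.
  generalize (filter_and _ _ (Carg_vertical q x0 (PI / 2) Hq HP2) Hy).
  apply filter_imp. intros y [Hang [Hy0 Hy1]].
  apply curve_complement_ray with x0; [unfold halfplane; simpl; lra|].
  intros l t Hl Ht E.
  destruct (sle0_rho_m4_curve_equations _ _ _ _ _ t Hx0 Hs Ht) as [H1 [H2 [_ H4]]].
  rewrite E in H4.
  replace (q + Ci * y - x0)%C with ((q - x0, y) : C) in *
    by (apply injective_projections; simpl; ring).
  assert (Hn : ((q - x0, y) : C) <> 0%C) by (intros E'; injection E'; lra).
  rewrite Carg_scale, Im_div_sqr_scale, Cmod_pair_sqr in H4;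
    try assumption; try lra; [|simpl; lra].
  change (Im (q - x0, y)) with y in H4.
  apply Rlt_div_r in Hy1; [|lra].
  assert (Hb : x0 * (y / ((q - x0) ^ 2 + y ^ 2) / l) < PI / 2); [|lra].
  apply Rle_lt_trans with (x0 * y / (q - x0) ^ 2).
  + unfold Rdiv. rewrite !Rmult_assoc. apply Rmult_le_compat_l; [lra|].
    apply Rmult_le_compat_l; [lra|].
    rewrite <- (Rmult_1_r (/ (q - x0) ^ 2)).
    apply Rmult_le_compat.
    * apply Rlt_le, Rinv_0_lt_compat. nra.
    * apply Rlt_le, Rinv_0_lt_compat. lra.
    * apply Rinv_le_contravar; nra.
    * rewrite <- Rinv_1. apply Rinv_le_contravar; lra.
  + apply Rlt_div_l; lra.
Qed.

(** * Behaviour at infinity for rho >= -2 *)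

Lemma before_infinity (P : R -> Prop) (M : R) :
  (forall t, M < t -> P t) -> before p_infty P.
Proof. intros H. exists M. intros t Ht _. apply H, Ht. Qed.

(** The imaginary equation confines the curve to the strip 0 <= Im <= PI x0, so it can only escape
    horizontally; the real equation sends it to the right, where its argument around x0 tends to 0
    and Im to PI x0. *)
Lemma sle0_rho_m2_asymptotic (x0 : R) (W x : R -> R) (tau : Rbar) (gamma : R -> C) :
  0 < x0 -> chordal_SLE0 (-2) x0 W x tau gamma ->
  tends_to_infinity gamma tau /\
  asymptotic_to gamma tau
    (fun z => exists a : R, 0 < a /\ z = (a + Ci * (PI * x0))%C).
Proof.
intros Hx0 Hs.
assert (Etau := sle0_lifetime_infinite _ _ _ _ _ _ Hx0 Hs ltac:(lra)).
assert (HPI := PI_RGT_0).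
assert (HRe : forall M, before tau (fun t => upto tau t /\ M < Re (gamma t))).
{ intros M'. set (M := Rmax 0 M').
  assert (HM0 : 0 <= M) by apply Rmax_l. assert (HM1 : M' <= M) by apply Rmax_r.
  (* An upper bound of Re + x0 ln r - x0 ln x0 when Re <= M, from x0 ln r <= r / 2 + x0 ln(2 x0).
     The slope 1/2, less than 1, also covers very negative Re, since then Re + |Re| / 2 <= 0. *)
  set (K := 3 / 2 * M + (x0 + PI * x0) / 2 + x0 * ln (2 * x0) - x0 * ln x0).
  rewrite Etau. apply before_infinity with (Rmax 0 (x0 / 2 * K)).
  intros t Ht.
  assert (Ht0 : 0 < t) by (apply Rle_lt_trans with (2 := Ht), Rmax_l).
  assert (HtK : x0 / 2 * K < t) by (apply Rle_lt_trans with (2 := Ht), Rmax_r).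
  assert (Hu : upto p_infty t) by (split; [lra|exact I]).
  split; [exact Hu|]. apply Rle_lt_trans with (1 := HM1). apply Rnot_le_lt. intros HX.
  rewrite <- Etau in Hu.
  destruct (sle0_rho_m2_curve_equations _ _ _ _ _ t Hx0 Hs Hu) as [H1 [H2 [H3 H4]]].
  destruct (Carg_bound (gamma t - x0)%C) as [HA _]; [rewrite Im_minus_RtoC; exact H1|].
  apply Cmod_gt_0 in H2.
  assert (Hr : Cmod (gamma t - x0)%C <= Rabs (Re (gamma t)) + x0 + PI * x0).
  { replace (gamma t - x0)%C with
      (RtoC (Re (gamma t)) + RtoC (- x0) + Ci * RtoC (Im (gamma t)))%C
      by (apply injective_projections; simpl; unfold Re, Im; ring).
    apply Rle_trans with (1 := Cmod_triangle _ _).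
    assert (H5 := Cmod_triangle (RtoC (Re (gamma t))) (RtoC (- x0))).
    rewrite Cmod_mult, Cmod_Ci, !Cmod_R in *.
    rewrite Rabs_Ropp, (Rabs_pos_eq x0) in H5 by lra.
    rewrite (Rabs_pos_eq (Im _)) by exact H1. nra. }
  set (r := Cmod (gamma t - x0)%C) in *. set (X := Re (gamma t)) in *.
  assert (Hln : x0 * ln r <= r / 2 + x0 * ln (2 * x0)).
  { assert (H := exp_ineq1_le (ln (r / (2 * x0)))).
    assert (Hq : 0 < r / (2 * x0)) by (apply Rdiv_lt_0_compat; lra).
    rewrite exp_ln in H by exact Hq. rewrite ln_div in H by lra.
    assert (x0 * (ln r - ln (2 * x0)) <= x0 * (r / (2 * x0)))
      by (apply Rmult_le_compat_l; lra).
    replace (x0 * (r / (2 * x0))) with (r / 2) in H0 by (field; lra). lra. }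
  assert (HXa : X + Rabs X / 2 <= 3 / 2 * M) by (unfold Rabs; destruct (Rcase_abs X); lra).
  assert (HK : K < 2 / x0 * t).
  { replace K with (2 / x0 * (x0 / 2 * K)) by (field; lra).
    apply Rmult_lt_compat_l; [apply Rdiv_lt_0_compat; lra|exact HtK]. }
  unfold K in HK. lra. }
assert (FB := before_filter tau).
split.
- intros P [M HM]. unfold filtermap. generalize (HRe M). apply filter_imp.
  intros t [_ Ht]. apply HM. apply Rlt_le_trans with (1 := Ht).
  apply Rle_trans with (2 := re_le_Cmod (gamma t)), Rle_abs.
- intros eps He.
  assert (He' : 0 < eps / x0) by (apply Rdiv_lt_0_compat; lra).
  assert (Hm := acos_modulus_pos (eps / x0) He').
  set (m := 2 * sin (Rmin (eps / x0) PI / 2) ^ 2) in Hm.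
  assert (Hq : 0 < PI * x0 / m) by (apply Rdiv_lt_0_compat; nra).
  (* With X = Re - x0 > PI x0 / m and r - X <= Im <= PI x0, one gets 1 - X / r < m, the closeness to
     acos 1 = 0 required by the modulus. *)
  generalize (HRe (x0 + PI * x0 / m)). apply filter_imp.
  intros t [Hu Ht].
  destruct (sle0_rho_m2_curve_equations _ _ _ _ _ t Hx0 Hs Hu) as [H1 [H2 [_ H4]]].
  assert (HI : 0 <= Im (gamma t - x0)%C) by (rewrite Im_minus_RtoC; exact H1).
  destruct (Carg_bound (gamma t - x0)%C HI) as [HA _].
  exists (Re (gamma t) + Ci * (PI * x0))%C. split.
  + exists (Re (gamma t)). split; [lra|reflexivity].
  + replace (gamma t - (Re (gamma t) + Ci * (PI * x0)))%C with
      (Ci * RtoC (Im (gamma t) - PI * x0))%C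
      by (apply injective_projections; simpl; unfold Re, Im; ring).
    rewrite Cmod_mult, Cmod_Ci, Cmod_R, Rmult_1_l.
    replace (Im (gamma t) - PI * x0) with (- (x0 * Carg (gamma t - x0)%C)) by lra.
    rewrite Rabs_Ropp, Rabs_pos_eq by nra.
    rewrite Rmult_comm. apply Rlt_div_r; [lra|].
    assert (HX : Re (gamma t - x0)%C = Re (gamma t) - x0) by (rewrite Cminus_RtoC; reflexivity).
    assert (Hrr : Cmod (gamma t - x0)%C <= Re (gamma t - x0)%C + Im (gamma t - x0)%C).
    { assert (H := Cmod2_alt (gamma t - x0)%C). assert (H0 := Cmod_ge_0 (gamma t - x0)%C). nra. }
    assert (HXr := re_le_Cmod (gamma t - x0)%C). rewrite Rabs_pos_eq in HXr by lra.
    rewrite Im_minus_RtoC in Hrr.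
    rewrite Carg_upper by exact HI.
    rewrite <- (Rabs_pos_eq (acos _)) by apply acos_bound.
    rewrite <- (Rminus_0_r (acos _)), <- acos_1.
    apply acos_modulus; [exact He'|apply Re_div_Cmod_bound|lra|].
    fold m. apply Cmod_gt_0 in H2.
    set (r := Cmod (gamma t - x0)%C) in *. set (X := Re (gamma t - x0)%C) in *.
    replace (X / r - 1) with (- ((r - X) / r)) by (field; lra).
    rewrite Rabs_Ropp, Rabs_pos_eq by (apply Rdiv_le_0_compat; lra).
    apply Rlt_div_l; [lra|].
    assert (HXm : PI * x0 / m < X) by lra.
    apply Rlt_div_l in HXm; [|lra]. nra.
Qed.

(** Shifting the origin changes the cosine of the argument by at most 2 |c| / |z - c|, from the
    triangle inequality; the modulus of acos turns this into angles. *)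
Lemma Carg_translate (c eps : R) :
  0 < eps -> exists M, forall z : C, 0 <= Im z -> M < Cmod z ->
    Rabs (Carg (z - c)%C - Carg z) < eps.
Proof.
intros He. assert (Hm := acos_modulus_pos eps He).
set (m := 2 * sin (Rmin eps PI / 2) ^ 2) in Hm.
assert (Hc := Rabs_pos c).
exists (Rabs c + 2 * Rabs c / m). intros z HI Hz.
assert (Hq : 0 <= 2 * Rabs c / m) by (apply Rdiv_le_0_compat; lra).
rewrite !Carg_upper; [|exact HI|rewrite Im_minus_RtoC; exact HI].
apply acos_modulus; try assumption; try apply Re_div_Cmod_bound. fold m.
assert (Hd := Cmod_close (z - c)%C z).
replace (z - c - z)%C with (RtoC (- c)) in Hd by (rewrite RtoC_opp; ring).
rewrite Cmod_R, Rabs_Ropp in Hd.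
assert (HX := re_le_Cmod z).
assert (ERe : Re (z - c)%C = Re z - c) by (rewrite Cminus_RtoC; reflexivity).
rewrite ERe.
set (r := Cmod z) in *. set (r' := Cmod (z - c)%C) in *. set (X := Re z) in *.
assert (Hr' : 2 * Rabs c / m < r') by (apply Rabs_le_between in Hd; lra).
assert (Hr0 : 0 < r') by lra. assert (Hr1 : 0 < r) by lra.
replace ((X - c) / r' - X / r) with ((X * (r - r') - c * r) / (r' * r)) by (field; lra).
rewrite Rabs_div, (Rabs_pos_eq (r' * r)) by nra.
apply Rle_lt_trans with (2 * Rabs c * r / (r' * r)).
- apply Rmult_le_compat_r; [apply Rlt_le, Rinv_0_lt_compat; nra|].
  apply Rle_trans with (1 := Rabs_triang _ _).
  rewrite Rabs_Ropp, !Rabs_mult, (Rabs_pos_eq r) by lra.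
  rewrite Rabs_minus_sym in Hd.
  assert (Rabs X * Rabs (r - r') <= r * Rabs c)
    by (apply Rmult_le_compat; try apply Rabs_pos; assumption).
  lra.
- replace (2 * Rabs c * r / (r' * r)) with (2 * Rabs c / r') by (field; lra).
  apply Rlt_div_l; [lra|]. apply Rlt_div_l in Hr'; lra.
Qed.

(** Both weights are positive, so a bounded curve would bound the logarithmic combination from
    above, while D tends to infinity. Far away the arguments around x0 and p both approach that of
    [gamma t], and the angular equation becomes (4 + rho) A ~ (2 + rho) PI. *)
Lemma sle0_escapes (rho x0 : R) (W x : R -> R) (tau : Rbar) (gamma : R -> C) :
  0 < x0 -> chordal_SLE0 rho x0 W x tau gamma -> -2 < rho ->
  tends_to_infinity gamma tau /\
  filterlim (fun t => Carg (gamma t)) (before tau)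
    (locally (PI * ((2 + rho) / (4 + rho)))).
Proof.
intros Hx0 Hs Hr.
assert (Etau := sle0_lifetime_infinite _ _ _ _ _ _ Hx0 Hs ltac:(lra)).
set (p := - 2 / (2 + rho) * x0).
assert (Hk : 0 < 2 / (2 + rho)) by (apply Rdiv_lt_0_compat; lra).
assert (Hinf : forall M, before tau (fun t => upto tau t /\ M < Cmod (gamma t))).
{ intros M'. set (M := Rmax 0 M').
  assert (HM0 : 0 <= M) by apply Rmax_l. assert (HM1 : M' <= M) by apply Rmax_r.
  assert (Hp := Rabs_pos p).
  set (d := x0 + Rabs p).
  (* The value of D at which (4 + rho) ln D + 2 ln(2 / (2 + rho)) equals (4 + rho) ln(M + d), the
     largest value of the left side while |gamma| <= M. The time below makes D^2 exceed K^2. *)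
  set (K := exp (ln (M + d) - 2 / (4 + rho) * ln (2 / (2 + rho)))).
  rewrite Etau. apply before_infinity with (K ^ 2 / (2 * (2 + rho))).
  intros t Ht.
  assert (Ht0 : 0 < t).
  { apply Rle_lt_trans with (2 := Ht), Rdiv_le_0_compat; [apply pow2_ge_0|lra]. }
  assert (Hu : upto p_infty t) by (split; [lra|exact I]).
  split; [exact Hu|]. apply Rle_lt_trans with (1 := HM1). apply Rnot_le_lt. intros HX.
  rewrite <- Etau in Hu.
  destruct (sle0_curve_equations rho x0 W x tau gamma t Hx0) as [H1 [H2 [H3 [H4 _]]]];
    try assumption; try lra.
  fold p in H3, H4.
  assert (HD := sle0_gap_pos _ _ _ _ _ _ Hx0 Hs t Hu).
  assert (HD2 := sle0_gap_sqr _ _ _ _ _ _ Hs t Hu).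
  rewrite (Rabs_pos_eq (2 / (2 + rho))), ln_mult in H4 by lra.
  assert (Htri : forall c : R, Cmod (gamma t - c)%C <= Cmod (gamma t) + Rabs c).
  { intros c. assert (H := Cmod_triangle (gamma t) (- c)%C).
    rewrite Cmod_opp, Cmod_R in H. exact H. }
  assert (T1 := Htri x0). assert (T2 := Htri p). rewrite (Rabs_pos_eq x0) in T1 by lra.
  apply Cmod_gt_0 in H2. apply Cmod_gt_0 in H3.
  assert (L1 : ln (Cmod (gamma t - x0)%C) <= ln (M + d)) by (apply ln_le; unfold d; lra).
  assert (L2 : ln (Cmod (gamma t - p)%C) <= ln (M + d)) by (apply ln_le; unfold d; lra).
  assert (HKD : K < x t - W t).
  { apply Rlt_div_l in Ht; [|lra].
    assert (HK0 : 0 < K) by apply exp_pos. nra. }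
  assert (HlnK : ln K < ln (x t - W t)) by (apply ln_increasing; [apply exp_pos|exact HKD]).
  unfold K in HlnK. rewrite ln_exp in HlnK.
  apply Rmult_lt_compat_l with (r := 4 + rho) in HlnK; [|lra].
  replace ((4 + rho) * (ln (M + d) - 2 / (4 + rho) * ln (2 / (2 + rho)))) with
    ((4 + rho) * ln (M + d) - 2 * ln (2 / (2 + rho))) in HlnK by (field; lra).
  assert ((2 + rho) * ln (Cmod (gamma t - x0)%C) <= (2 + rho) * ln (M + d))
    by (apply Rmult_le_compat_l; lra).
  lra. }
assert (FB := before_filter tau).
split.
- intros P [M HM]. unfold filtermap. generalize (Hinf M). apply filter_imp.
  intros t [_ Ht]. apply HM, Ht.
- apply filterlim_R_iff; [exact FB|]. intros eps He.
  destruct (Carg_translate x0 eps He) as [M1 HM1].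
  destruct (Carg_translate p eps He) as [M2 HM2].
  generalize (filter_and _ _ (Hinf M1) (Hinf M2)). apply filter_imp.
  intros t [[Hu K1] [_ K2]].
  destruct (sle0_curve_equations rho x0 W x tau gamma t Hx0) as [H1 [_ [_ [_ H5]]]];
    try assumption; try lra.
  fold p in H5.
  assert (Es : arg_of_sign (2 / (2 + rho)) = 0).
  { unfold arg_of_sign. destruct (Rlt_dec 0 (2 / (2 + rho))); [reflexivity|lra]. }
  rewrite Es in H5.
  specialize (HM1 _ H1 K1). specialize (HM2 _ H1 K2).
  apply Rabs_def2 in HM1. apply Rabs_def2 in HM2.
  set (A := Carg (gamma t)) in *.
  assert (E : (4 + rho) * (A - PI * ((2 + rho) / (4 + rho))) = (4 + rho) * A - (2 + rho) * PI)
    by (field; lra).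
  apply Rabs_def1; apply Rmult_lt_reg_l with (4 + rho); try lra; rewrite E; nra.
Qed.

Theorem corollary2 (rho x0 : R) (W x : R -> R) (tau : Rbar) (gamma : R -> C)
    (hx0 : 0 < x0) (hsle : chordal_SLE0 rho x0 W x tau gamma) :
  (rho <= -4 ->
     filterlim gamma (before tau) (locally (RtoC x0)) /\
     outer_hitting_angle gamma tau x0 (PI * ((4 + rho) / (2 + rho))) /\
     tau = Finite (- (x0 ^ 2 / (2 * (2 + rho))))) /\
  (-4 < rho < -2 ->
     filterlim gamma (before tau) (locally (RtoC (- (2 / (rho + 2)) * x0))) /\
     - (2 / (rho + 2)) * x0 > x0 /\
     outer_hitting_angle gamma tau (- (2 / (rho + 2)) * x0)
       (PI * ((4 + rho) / 2)) /\
     tau = Finite (- (x0 ^ 2 / (2 * (2 + rho))))) /\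
  (rho = -2 ->
     tends_to_infinity gamma tau /\
     asymptotic_to gamma tau
       (fun z => exists a : R, 0 < a /\ z = (a + Ci * (PI * x0))%C)) /\
  (-2 < rho ->
     tends_to_infinity gamma tau /\
     filterlim (fun t => Carg (gamma t)) (before tau)
       (locally (PI * ((2 + rho) / (4 + rho))))).
Proof.
split; [|split; [|split]].
- intros Hr.
  assert (Etau := sle0_lifetime_finite _ _ _ _ _ _ hx0 hsle ltac:(lra)).
  assert (H : filterlim gamma (before tau) (locally (RtoC x0)) /\
    outer_hitting_angle gamma tau x0 (PI * ((4 + rho) / (2 + rho)))); [|tauto].
  destruct Hr as [Hr| ->]; [exact (sle0_hits_force_point _ _ _ _ _ _ hx0 hsle Hr)|].
  replace (PI * ((4 + -4) / (2 + -4))) with 0 by field.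
  exact (sle0_rho_m4_hits _ _ _ _ _ hx0 hsle).
- intros Hr.
  assert (Etau := sle0_lifetime_finite _ _ _ _ _ _ hx0 hsle ltac:(lra)).
  assert (H := sle0_hits_dual_point _ _ _ _ _ _ hx0 hsle Hr). tauto.
- intros ->. exact (sle0_rho_m2_asymptotic _ _ _ _ _ hx0 hsle).
- exact (sle0_escapes _ _ _ _ _ _ hx0 hsle).
Qed.
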